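(* Let $K$ be a field. Given as input an $m\times n$ bigraded matrix $[\gamma]$ representing a morphism $\gamma:F\to F'$ of finitely generated free bipersistence modules, the algorithm $\mathsf{KerBasis}$ (which computes a basis for $\ker\gamma$) runs in $$O\big(n(m+n)\min(m,n)\big)$$ time and requires $O(mn+n^2)$ memory.
   Context: A bipersistence module is a $K[x_1,x_2]$-module $M$ with a vector space decomposition $M=\bigoplus_{\mathbf z\in\mathbb Z^2}M_{\mathbf z}$ such that $x_iM_{\mathbf z}\subset M_{\mathbf z+\mathbf e_i}$. Morphisms are module homomorphisms preserving grades. $\mathbb Z^2$ carries the product partial order $\le$. A bipersistence module is free if it is isomorphic to a direct sum of modules $Q^{\mathbf g}$, $\mathbf g\in\mathbb Z^2$, where $Q^{\mathbf g}_{\mathbf z}=K$ if $\mathbf g\le\mathbf z$ and $0$ otherwise, with identity maps between the copies of $K$. A basis of a free module is a minimal homogeneous generating set. For a homogeneous element $b$, $\mathrm{gr}(b)$ is its grade. Given an ordered basis $B$ of a finitely generated free module $F$ and $v\in F_{\mathbf z}$, $[v]^B\in K^{|B|}$ is the unique vector with $[v]^B_i=0$ if $\mathrm{gr}(B_i)\not\le\mathbf z$ and $v=\sum_{i:\mathrm{gr}(B_i)\le \mathbf z}[v]^B_i x^{\mathbf z-\mathrm{gr}(B_i)}B_i$. The matrix $[\gamma]$, with respect to ordered bases $B,B'$ of $F,F'$, has $j$-th column $[\gamma(B_j)]^{B'}$, labeled by $\mathrm{gr}(B_j)$. A bigraded matrix is a matrix over $K$ with columns labeled by elements of $\mathbb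 Z^2$ in colexicographical order (second coordinate compared first); the label of column $j$ of $R$ is $\mathrm{gr}(R)_j$. The pivot $\rho^R_j$ of column $R( *,j)$ is the largest index of a nonzero entry, or $\mathsf{null}$ if the column is zero. Let $S\subset\mathbb Z^2$ be the set of column labels, and $\mathrm{grid}(F)=\{(z_1,z_2): (z_1,y)\in S\text{ and }(x,z_2)\in S\text{ for some }x,y\}$. Algorithm $\mathsf{KerBasis}$. Initialize $R=[\gamma]$, $V=$ the $n\times n$ identity matrix, and an empty output list. For each $\mathbf z=(z_1,z_2)\in\mathrm{grid}(F)$ in lexicographical order (first coordinate compared first), do the following: (1) For each column index $j$ with $\mathrm{gr}(R)_j=(y,z_2)$ for some $y\le z_1$, in increasing order of $j$: while there exists $k<j$ with $\mathrm{gr}(R)_k\le\mathbf z$ and $\mathsf{null}\ne\rho^R_j=\rho^R_k$, add $-\frac{R(\rho^R_j,j)}{R(\rho^R_j,k)}R( *,k)$ to $R( *,j)$, and perform the same column operation on $V$. (2) For each $j$ such that column $R( *,j)$ was first found to be zero in step (1) for this $\mathbf z$ (that is, $j$ is among the indices treated in step (1), $R( *,j)=0$ after step (1), and $j$ was not recorded at an earlier grade), append $(V( *,j),\mathbf z)$ to the output list. Implementation of the while-condition: an array $\mathsf{pivs}$ of length $m$ is initialized with all entries $\mathsf{null}$. With $\ell=\rho^R_j$: if $\ell=\mathsf{null}$, $\mathsf{pivs}[\ell]=\mathsf{null}$ or $\mathsf{pivs}[\ell]\ge j$, the while-condition is deemed false, and if moreover $\ell\ne\mathsf{null}$ and ($\mathsf{pivs}[\ell]>j$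 or $\mathsf{pivs}[\ell]=\mathsf{null}$) one sets $\mathsf{pivs}[\ell]\leftarrow j$; otherwise $k=\mathsf{pivs}[\ell]$ is used. Cost model: field operations take $O(1)$ time, a field element takes $O(1)$ memory (likewise labels in $\mathbb Z^2$), the pivot of a column is accessed in $O(1)$ time, and column additions in a matrix with $r$ rows take $O(r)$ time. *)

(* Defs.v *)
From HB Require Import structures.
From mathcomp Require Import all_boot all_order all_algebra.
From mathcomp Require Import mpoly.

Set Implicit Arguments.
Unset Strict Implicit.
Unset Printing Implicit Defensive.

Import Order.TTheory GRing.Theory Num.Theory.
Local Open Scope ring_scope.

Notation grade := (int * int)%type.

Definition gle (g z : grade) : bool := (g.1 <= z.1) && (g.2 <= z.2).

Definition colex (g z : grade) : bool :=
  (g.2 < z.2) || ((g.2 == z.2) && (g.1 <= z.1)).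

Definition x1 (K : fieldType) : {mpoly K[2]} := 'X_ord0.
Definition x2 (K : fieldType) : {mpoly K[2]} := 'X_ord_max.

(* The monomial x^(z - g); only meaningful when [gle g z]. *)
Definition xpow (K : fieldType) (g z : grade) : {mpoly K[2]} :=
  x1 K ^+ `|z.1 - g.1|%N * x2 K ^+ `|z.2 - g.2|%N.

(* [bp_span] and [bp_direct] together say that the K-subspaces [bp_gr z] are
   in direct sum and fill the whole module. *)
Record bipersistence (K : fieldType) := Bipersistence {
  bp_mod :> lmodType {mpoly K[2]};
  bp_gr : grade -> bp_mod -> Prop;
  bp_zero : forall z, bp_gr z 0;
  bp_lin : forall z (c : K) u v,
    bp_gr z u -> bp_gr z v -> bp_gr z (c%:MP *: u + v);
  bp_span : forall v, exists2 t : seq (grade * bp_mod),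
    (forall p, p \in t -> bp_gr p.1 p.2) & v = \sum_(p <- t) p.2;
  bp_direct : forall (s : seq grade) (f : grade -> bp_mod), uniq s ->
    (forall z, bp_gr z (f z)) -> \sum_(z <- s) f z = 0 ->
    forall z, z \in s -> f z = 0;
  bp_x1 : forall z v, bp_gr z v -> bp_gr (z.1 + 1, z.2) (x1 K *: v);
  bp_x2 : forall z v, bp_gr z v -> bp_gr (z.1, z.2 + 1) (x2 K *: v)
}.

Definition grade_preserving (K : fieldType) (M N : bipersistence K)
    (f : M -> N) : Prop :=
  forall z v, bp_gr z v -> bp_gr z (f v).

(* Q^g is carried by K[x1,x2]: the copy of K in grade z >= g is the line
   spanned by x^(z - g), and the identity from grade z to grade w >= z is
   multiplication by x^(w - z). *)
Definition Q_gr (K : fieldType) (g z : grade) (p : {mpoly K[2]}) : Prop :=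
  exists c : K, p = if gle g z then c *: xpow K g z else 0.

Section FreeModule.
Variables (K : fieldType) (k : nat) (h : 'I_k -> grade).

Definition free_gr (z : grade) (v : 'rV[{mpoly K[2]}]_k) : Prop :=
  forall i, Q_gr (h i) z (v 0 i).

Lemma xpowE (g z : grade) :
  xpow K g z = 'X_[(U_(ord0) *+ `|z.1 - g.1|%N + U_(ord_max) *+ `|z.2 - g.2|%N)%MM].
Proof. by rewrite /xpow /x1 /x2 !mpolyXn -mpolyXD. Qed.

Lemma mcoeff_xpow (g z w : grade) : gle g z -> gle g w ->
  (xpow K g z)@_(U_(ord0) *+ `|w.1 - g.1|%N + U_(ord_max) *+ `|w.2 - g.2|%N)%MM
  = (z == w)%:R.
Proof.
move=> /andP[z1 z2] /andP[w1 w2]; rewrite xpowE mcoeffX; congr ((nat_of_bool _)%:R).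
apply/idP/idP => [/eqP e|/eqP -> //].
have e1 := congr1 (fun m : 'X_{1..2} => m ord0) e.
have e2 := congr1 (fun m : 'X_{1..2} => m ord_max) e.
move: e1 e2; rewrite !mnmDE !mulmnE !mnm1E /= ?muln0 ?muln1 ?mul0n ?mul1n ?addn0 ?add0n => e1 e2.
have {}e1 : z.1 - g.1 = w.1 - g.1.
  by rewrite -[LHS]gez0_abs ?subr_ge0 // -[RHS]gez0_abs ?subr_ge0 // e1.
have {}e2 : z.2 - g.2 = w.2 - g.2.
  by rewrite -[LHS]gez0_abs ?subr_ge0 // -[RHS]gez0_abs ?subr_ge0 // e2.
by move/addIr: e1; move/addIr: e2; case: (z) (w) => [a b] [c d] /= -> ->.
Qed.

Lemma free_zero z : free_gr z 0.
Proof. by move=> i; exists 0; rewrite mxE scale0r; case: ifP. Qed.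

Lemma free_lin z (c : K) u v :
  free_gr z u -> free_gr z v -> free_gr z (c%:MP *: u + v).
Proof.
move=> hu hv i; rewrite !mxE; have [a ->] := hu i; have [b ->] := hv i.
exists (c * a + b); case: ifP => _; last by rewrite mulr0 addr0.
by rewrite mul_mpolyC scalerA scalerDl.
Qed.

Lemma free_span v : exists2 t : seq (grade * 'rV[{mpoly K[2]}]_k),
  (forall p, p \in t -> free_gr p.1 p.2) & v = \sum_(p <- t) p.2.
Proof.
pose gm (i : 'I_k) (m : 'X_{1..2}) : grade :=
  ((h i).1 + (m ord0)%:Z, (h i).2 + (m ord_max)%:Z).
pose hm (i : 'I_k) (m : 'X_{1..2}) : 'rV[{mpoly K[2]}]_k :=
  ((v 0 i)@_m *: 'X_[m]) *: delta_mx 0 i.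
pose t i := [seq (gm i m, hm i m) | m <- msupp (v 0 i)].
exists (flatten [seq t i | i <- enum 'I_k]).
  move=> p /flattenP[s /mapP[i _ ->] /mapP[m _ ->]] j; rewrite /= /hm !mxE /=.
  have [->|ne] := eqVneq j i; last first.
    by exists 0; rewrite mulr0 scale0r; case: ifP.
  exists ((v 0 i)@_m); rewrite mulr1 /gle /= !lerDl /=.
  rewrite xpowE /= !(addrC (_ (h i))) !addrK /=; congr (_ *: 'X_[_]).
  apply/mnmP => a; rewrite mnmDE !mulmnE !mnm1E.
  by case: a => [[|[|a]] //= la]; rewrite ?muln1 ?muln0 ?addn0 ?add0n ?mul1n ?mul0n;
    congr (m _); apply: val_inj.
rewrite big_flatten big_map big_enum /= {1}[v]row_sum_delta.
apply: eq_bigr => i _; rewrite big_map /= {1}[v 0 i]mpolyE scaler_suml.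
by [].
Qed.

Lemma free_direct (s : seq grade) (f : grade -> 'rV[{mpoly K[2]}]_k) : uniq s ->
  (forall z, free_gr z (f z)) -> \sum_(z <- s) f z = 0 ->
  forall z, z \in s -> f z = 0.
Proof.
move=> us hf s0 z zs; apply/rowP => i; rewrite mxE.
have [c] := hf z i; case: ifP => // giz fz; rewrite fz.
have /(congr1 (fun v : 'rV_k => (v 0 i)@_(U_(ord0) *+ `|z.1 - (h i).1|%N
   + U_(ord_max) *+ `|z.2 - (h i).2|%N)%MM)) := s0.
rewrite summxE raddf_sum /= mxE mcoeff0 (bigD1_seq z) //= fz mcoeffZ.
rewrite mcoeff_xpow // eqxx mulr1 big1 ?addr0 => [->|w nwz]; first by rewrite scale0r.
have [d ->] := hf w i; case: ifP => giw; last by rewrite mcoeff0.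
by rewrite mcoeffZ mcoeff_xpow // (negPf nwz) mulr0.
Qed.

Lemma free_x (x : {mpoly K[2]}) (w : grade -> grade) :
  (forall g z, gle g z -> gle g (w z) /\ x * xpow K g z = xpow K g (w z)) ->
  forall z v, free_gr z v -> free_gr (w z) (x *: v).
Proof.
move=> hw z v hv i; rewrite mxE; have [c ->] := hv i.
case: ifP => [/hw[gw e]|_]; first by exists c; rewrite gw -scalerAr e.
by exists 0; rewrite mulr0 scale0r; case: ifP.
Qed.

Lemma absz_succ (a b : int) : b <= a -> absz (a + 1 - b)%R = (absz (a - b)%R).+1.
Proof.
move=> ba; apply/eqP; rewrite -eqz_nat intS !gez0_abs ?subr_ge0 //.
  by rewrite addrAC addrC.
by rewrite (le_trans ba) // lerDl.
Qed.

Lemma free_x1 z v : free_gr z v -> free_gr (z.1 + 1, z.2) (x1 K *: v).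
Proof.
apply: (@free_x (x1 K) (fun z => (z.1 + 1, z.2))) => g {}z /andP[z1 z2].
rewrite /gle /= z2 (le_trans z1) ?lerDl //; split=> //.
by rewrite /xpow /= absz_succ // exprS mulrA.
Qed.

Lemma free_x2 z v : free_gr z v -> free_gr (z.1, z.2 + 1) (x2 K *: v).
Proof.
apply: (@free_x (x2 K) (fun z => (z.1, z.2 + 1))) => g {}z /andP[z1 z2].
rewrite /gle /= z1 (le_trans z2) ?lerDl //; split=> //.
by rewrite /xpow /= absz_succ // exprS mulrCA.
Qed.

(* The direct sum of the Q^(h i). *)
Definition free_module : bipersistence K :=
  Bipersistence free_zero free_lin free_span free_direct free_x1 free_x2.

End FreeModule.

Section Bases.
Variables (K : fieldType) (M : bipersistence K).

(* [U] is the underlying set of a graded submodule of [M], either all of [M]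
   or the kernel of a morphism. *)
Definition fg_free (U : M -> Prop) : Prop :=
  exists (k : nat) (h : 'I_k -> grade) (f : {linear free_module K h -> M}),
    [/\ grade_preserving f, injective f & forall v, U v <-> exists w, f w = v].

Definition generates (U : M -> Prop) k (b : 'I_k -> M) (D : {set 'I_k}) : Prop :=
  forall v, U v <->
    exists p : 'I_k -> {mpoly K[2]}, v = \sum_(i in D) p i *: b i.

Definition is_basis (U : M -> Prop) k (b : 'I_k -> M) (g : 'I_k -> grade) : Prop :=
  [/\ fg_free U,
      forall i, bp_gr (g i) (b i),
      generates U b setT &
      forall D : {set 'I_k}, D \proper setT -> ~ generates U b D].

(* [coordinates b g z v c] reads c = [v]^b for v in grade z. *)
Definition coordinates k (b : 'I_k -> M) (g : 'I_k -> grade)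
    (z : grade) (v : M) (c : 'cV[K]_k) : Prop :=
  [/\ bp_gr z v,
      forall i, ~~ gle (g i) z -> c i 0 = 0 &
      v = \sum_(i | gle (g i) z) ((c i 0)%:MP * xpow K (g i) z) *: b i].

End Bases.

Record bigraded_matrix (K : fieldType) (m n : nat) := BigradedMatrix {
  bg_mx :> 'M[K]_(m, n);
  bg_gr : 'I_n -> grade;
  bg_colex : forall i j : 'I_n, (i <= j)%N -> colex (bg_gr i) (bg_gr j)
}.

(* [A] is the matrix [f] with respect to the ordered bases [b] (graded by the
   column labels of [A]) and [b'] (graded by [g']). *)
Definition represents (K : fieldType) (M N : bipersistence K) (f : M -> N)
    m n (b : 'I_n -> M) (b' : 'I_m -> N) (g' : 'I_m -> grade)
    (A : bigraded_matrix K m n) : Prop :=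
  forall j, coordinates b' g' (bg_gr A j) (f (b j)) (col j A).

Definition pivot (K : fieldType) m n (R : 'M[K]_(m, n)) (j : 'I_n) : option 'I_m :=
  [pick i | (R i j != 0) && [forall l : 'I_m, (i < l)%N ==> (R l j == 0)]].

Section KerBasis.
Variables (K : fieldType) (m n : nat) (A : bigraded_matrix K m n).

Local Notation gr := (bg_gr A).

(* d_xs is the increasing list of first coordinates of column labels; d_rows
   lists, by increasing second coordinate y, the columns with label (_, y) in
   increasing order. Hence grid(F) in lexicographical order is the list of
   the (x, y), x in d_xs (outer loop) and y in unzip1 d_rows (inner loop). *)
Record data := Data {
  d_R : 'M[K]_(m, n);
  d_V : 'M[K]_n;
  d_pivs : {ffun 'I_m -> option 'I_n};
  d_found : {ffun 'I_n -> bool};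
  d_xs : seq int;
  d_rows : seq (int * seq 'I_n);
  d_out : seq ('cV[K]_n * grade)
}.

(* Number of memory words in use: the input and its labels; R, with the stored
   pivots of its columns; V; pivs; the marks "already recorded"; the two lists
   describing the grid; the output; and 8 registers for the loop variables. *)
Definition footprint (d : data) : nat :=
  ((m * n + n) + (m * n + n) + n * n + m + n
   + size (d_xs d)
   + \sum_(r <- d_rows d) (size r.2).+1
   + size (d_out d) * n.+1
   + 8)%N.

Record machine := Machine { dat : data; time : nat; peak : nat }.

(* Performs [f], which takes [c] units of time; [peak] is the largest footprint
   ever reached. The O(1) and O(r) of the cost model are normalized to small
   explicit multiples of 1 and to r. *)
Definition step (c : nat) (f : data -> data) (s : machine) : machine :=
  let d := f (dat s) in
  Machine d (time s + c)%N (maxn (peak s) (footprint d)).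

Definition tick (c : nat) : machine -> machine := step c id.

Definition put_pivs l j d :=
  Data (d_R d) (d_V d) [ffun i => if i == l then Some j else d_pivs d i]
       (d_found d) (d_xs d) (d_rows d) (d_out d).

Definition put_matrices R V d :=
  Data R V (d_pivs d) (d_found d) (d_xs d) (d_rows d) (d_out d).

Definition put_xs xs d :=
  Data (d_R d) (d_V d) (d_pivs d) (d_found d) xs (d_rows d) (d_out d).

Definition put_rows rows d :=
  Data (d_R d) (d_V d) (d_pivs d) (d_found d) (d_xs d) rows (d_out d).

Definition record_column j z d :=
  Data (d_R d) (d_V d) (d_pivs d)
       [ffun i => if i == j then true else d_found d i]
       (d_xs d) (d_rows d) (rcons (d_out d) (col j (d_V d), z)).

(* Adds c times column k to column j. *)
Definition add_col r (c : K) (k j : 'I_n) (M : 'M[K]_(r, n)) : 'M[K]_(r, n) :=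
  \matrix_(i, l) if l == j then M i j + c * M i k else M i l.

(* Executes [body] on the elements of [s], stopping at the first one for which
   [test] fails; [None] means that some inner loop ran out of fuel. *)
Fixpoint for_while T (test : T -> bool) (body : T -> machine -> option machine)
    (s : seq T) (st : machine) : option machine :=
  let st := tick 1 st in
  if s is a :: s' then
    if test a then obind (for_while test body s') (body a st) else Some st
  else Some st.

Definition for_all T := @for_while T xpredT.

(* [None] stands for running out of fuel, so that an answer [Some _] does not
   depend on the fuel. [body] returns [false] when the condition of the loop fails. *)
Fixpoint while (fuel : nat) (body : machine -> bool * machine)
    (st : machine) : option machine :=
  if fuel is fuel'.+1 then
    let (go_on, st') := body st in
    if go_on then while fuel' body st' else Some st'
  else None.

(* Sorted insertion without repetition, with the number of comparisons. *)
Fixpoint insert (x : int) (s : seq int) : nat * seq int :=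
  if s is y :: s' then
    if x == y then (1%N, s)
    else if x < y then (2%N, x :: s)
    else let (c, t) := insert x s' in (c.+2, y :: t)
  else (0%N, [:: x]).

Definition insert_x (j : 'I_n) (st : machine) : machine :=
  let (c, xs) := insert (gr j).1 (d_xs (dat st)) in step c.+1 (put_xs xs) st.

Definition insert_row (j : 'I_n) (st : machine) : machine :=
  let rows := d_rows (dat st) in
  step 2 (put_rows
    (if rows is (y, js) :: rows' then
       if (gr j).2 == y then (y, j :: js) :: rows' else ((gr j).2, [:: j]) :: rows
     else [:: ((gr j).2, [:: j])])) st.

(* Columns are visited from the last one to the first one. *)
Definition setup (st : machine) : option machine :=
  for_all (fun j st => Some (insert_row j (insert_x j st))) (rev (enum 'I_n)) st.

Definition reduce_step (j : 'I_n) (st : machine) : bool * machine :=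
  let d := dat st in
  let st := tick 2 st in (* reads the pivot and tests it *)
  if pivot (d_R d) j is Some l then
    let st := tick 3 st in (* reads pivs and performs at most two tests *)
    if d_pivs d l is Some k then
      if (k < j)%N then
        let c := - (d_R d l j / d_R d l k) in
        let st := tick 4 st in (* reads two entries, computes c *)
        (true, step (m + n)%N (put_matrices (add_col c k j (d_R d))
                                          (add_col c k j (d_V d))) st)
      else if (j < k)%N then (false, step 1 (put_pivs l j) st)
      else (false, st)
    else (false, step 1 (put_pivs l j) st)
  else (false, st).

Definition reduce (fuel : nat) (j : 'I_n) : machine -> option machine :=
  while fuel (reduce_step j).

Definition output_step (z : grade) (j : 'I_n) (st : machine) : machine :=
  let d := dat st in
  let st := tick 3 st in (* reads the pivot and the mark, and tests them *)
  if (pivot (d_R d) j == None) && ~~ d_found d j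
  then step n.+2 (record_column j z) st
  else st.

(* Since [js] is increasing and the labels are in colexicographical order, the
   columns in [js] with label (y, z.2), y <= z.1, form a prefix of [js]. *)
Definition process (fuel : nat) (z : grade) (js : seq 'I_n) (st : machine) :
    option machine :=
  obind (for_while (fun j => (gr j).1 <= z.1)
                   (fun j st => Some (output_step z j st)) js)
        (for_while (fun j => (gr j).1 <= z.1) (reduce fuel) js st).

Definition sweep (fuel : nat) (st : machine) : option machine :=
  for_all (fun x st =>
    for_all (fun r => process fuel (x, r.1) r.2) (d_rows (dat st)) st)
  (d_xs (dat st)) st.

(* Every word of the initial storage is read or written once. *)
Definition start : machine :=
  let d := Data A 1%:M [ffun => None] [ffun => false] [::] [::] [::] in
  Machine d (footprint d) (footprint d).

Definition kerbasis (fuel : nat) : option machine :=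
  obind (sweep fuel) (setup start).

Definition output_vec (st : machine) (i : 'I_(size (d_out (dat st)))) : 'cV[K]_n :=
  (tnth (in_tuple (d_out (dat st))) i).1.

Definition output_gr (st : machine) (i : 'I_(size (d_out (dat st)))) : grade :=
  (tnth (in_tuple (d_out (dat st))) i).2.

End KerBasis.

(* Main.v *)
Require Import Defs.
From mathcomp Require Import all_boot all_order all_algebra.
From mathcomp Require Import mpoly.
From HB Require Import structures.
From mathcomp Require Import zify.

(** Correctness. Column operations keep [R = A *m V] with [V] upper
    unitriangular. A column that is added to column [j] has been visited
    before and has a smaller index than [j], so its label is below the current
    grade; hence a column of [V] whose column of [R] vanishes is the
    coordinate vector of a kernel element of the current grade. A pass over the
    columns with first coordinate at most [x], in increasing order, leaves their
    nonzero columns in [R] with distinct pivots, so that relations between them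
    involve null columns only. The block of [V] formed by the columns with label
    below [(x, y)] is invertible, and therefore the null columns among them
    represent a basis of the vector space of kernel elements of grade [(x, y)]
    ([inv_complete]). A null column is never modified again, so this remains true
    of the final output at every grade ([kernel_spec]).

    To pass from these statements about vectors, one grade at a time, to the
    module [F], the bases [B] and [B'] must be linearly independent over the
    polynomial ring, whereas they are only known to be minimal generating sets of
    free modules. This is a graded form of Nakayama's lemma ([basis_independent]):
    the change of coordinates to a free family and back is the identity on one
    side, and by minimality it is the identity on the other side modulo the
    variables; so the two families have the same size, and one-sided inverses of
    square matrices are two-sided. Conversely an independent homogeneous
    generating family is a basis ([independent_basis]), which turns [kernel_spec]
    into the claim about the kernel ([kernel_spec_basis]).

    Cost. A column of [R] always lies in the column space of [A]. If [l] is the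
    pivot of a vector of this space, then row [l] of [A] is independent of the
    rows below it; hence at most [\rank A <= minn m n] indices are pivots of such
    vectors. Each addition strictly lowers the pivot of its column
    ([height_add_col]), so a column undergoes at most [minn m n] additions
    ([slack_lt]), each taking time O(m + n). The remaining work is constant per
    visit of a column, which makes O(n ^ 2) for the at most [n] passes, plus the
    initial storage and O(n) per output vector. The additions and the output are
    charged to a potential, so that each visit has constant amortized cost. *)

Set Implicit Arguments.
Unset Strict Implicit.
Unset Printing Implicit Defensive.

Import Order.TTheory GRing.Theory Num.Theory.
Local Open Scope ring_scope.

(** * Grades and exponents *)

Lemma gle_refl g : gle g g.
Proof. by rewrite /gle !lexx. Qed.

Lemma gle_trans h g z : gle g h -> gle h z -> gle g z.
Proof.
by move=> /andP[a1 a2] /andP[b1 b2]; rewrite /gle (le_trans a1 b1) (le_trans a2 b2).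
Qed.

(** The monomial by which grade [g] moves to grade [z]; [expo] and [shift] are
    inverse to each other on the grades above [g]. *)
Definition expo (g z : grade) : 'X_{1..2} :=
  (U_(ord0) *+ `|(z.1 - g.1)%R|%N + U_(ord_max) *+ `|(z.2 - g.2)%R|%N)%MM.

Definition shift (g : grade) (u : 'X_{1..2}) : grade :=
  (g.1 + (u ord0)%:Z, g.2 + (u ord_max)%:Z).

Lemma gle_shift g u : gle g (shift g u).
Proof. by rewrite /gle /shift /= !lerDl. Qed.

Lemma expo0 g z : expo g z ord0 = `|(z.1 - g.1)%R|%N.
Proof. by rewrite /expo mnmDE !mulmnE !mnm1E /= mul0n mul1n addn0. Qed.

Lemma expo1 g z : expo g z ord_max = `|(z.2 - g.2)%R|%N.
Proof. by rewrite /expo mnmDE !mulmnE !mnm1E /= mul0n mul1n add0n. Qed.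

Lemma mnm2P (u v : 'X_{1..2}) : u ord0 = v ord0 -> u ord_max = v ord_max -> u = v.
Proof.
move=> e0 e1; apply/mnmP => i; have [->//|ni] := eqVneq i ord0.
suff -> : i = ord_max by [].
by apply: val_inj; case: i ni => [[|[|i]]].
Qed.

Lemma shift_expo g z : gle g z -> shift g (expo g z) = z.
Proof.
case: z => z1 z2 /andP[/= h1 h2]; rewrite /shift expo0 expo1 /= !gez0_abs ?subr_ge0 //.
by rewrite ![_ + (_ - _)]addrC !subrK.
Qed.

Lemma expo_shift g u : expo g (shift g u) = u.
Proof. by apply: mnm2P; rewrite ?expo0 ?expo1 /shift /= addrAC subrr add0r. Qed.

(** * Homogeneous generating families *)

Section Graded.
Variable K : fieldType.
Implicit Types (p : {mpoly K[2]}) (g h z w : grade).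

Lemma xpow_expo g z : xpow K g z = 'X_[expo g z].
Proof. exact: xpowE. Qed.

Lemma xpow_refl g : xpow K g g = 1.
Proof. by rewrite /xpow !subrr !expr0 mulr1. Qed.

Lemma xpow_trans g h z : gle g h -> gle h z ->
  xpow K g h * xpow K h z = xpow K g z.
Proof.
move=> /andP[a1 a2] /andP[b1 b2].
rewrite !xpow_expo -mpolyXD; congr 'X_[_].
have abs_trans (a b c : int) : a <= b -> b <= c ->
    (`|(b - a)%R| + `|(c - b)%R| = `|(c - a)%R|)%N.
  move=> ab bc; apply/eqP; rewrite -eqz_nat PoszD !gez0_abs ?subr_ge0 //.
    by rewrite addrC addrA subrK.
  exact: le_trans bc.
by apply: mnm2P; rewrite mnmDE ?expo0 ?expo1 abs_trans.
Qed.

(** Only this coefficient of [p] matters in grade [z] when [p] multiplies an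
    element of grade [g]. *)
Definition gcoef g z p : K := if gle g z then p@_(expo g z) else 0.

Definition gpart g z p : {mpoly K[2]} := (gcoef g z p)%:MP * xpow K g z.

(** [gpart g z p] selects the single monomial of [p] that moves grade [g] to
    grade [z]. *)
Lemma mcoeff_gpart g z p u : (gpart g z p)@_u = p@_u *+ (z == shift g u).
Proof.
rewrite /gpart /gcoef xpow_expo mul_mpolyC mcoeffZ mcoeffX.
case: ifP => [gz|ngz].
  have -> : (expo g z == u) = (z == shift g u).
    by apply/eqP/eqP => [<-|->]; rewrite ?shift_expo ?expo_shift.
  by case: eqP => [->|_]; rewrite ?mulr0 // expo_shift mulr1.
by rewrite mul0r; case: eqP ngz => // ->; rewrite gle_shift.
Qed.

Lemma sum_gpart g p (s : seq grade) : uniq s ->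
  {subset [seq shift g u | u <- msupp p] <= s} -> p = \sum_(z <- s) gpart g z p.
Proof.
move=> us ss; apply/mpolyP => u; rewrite raddf_sum /=.
under eq_bigr do rewrite mcoeff_gpart.
have [us'|nus] := boolP (shift g u \in s).
  rewrite (bigD1_seq (shift g u)) //= eqxx big1 ?addr0 // => z nz.
  by rewrite (negPf nz).
rewrite big_seq big1 => [|z zs].
  apply/eqP; rewrite mcoeff_eq0; apply: contra nus => h.
  exact/ss/map_f.
by case: eqP zs => // ->; rewrite (negPf nus).
Qed.

Section Module.
Variable M : bipersistence K.

Lemma bp_scale z (c : K) (u : M) : bp_gr z u -> bp_gr z (c%:MP *: u).
Proof. by move=> hu; rewrite -[_ *: u]addr0; apply: bp_lin => //; apply: bp_zero. Qed.

Lemma bp_add z (u v : M) : bp_gr z u -> bp_gr z v -> bp_gr z (u + v).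
Proof. by move=> hu hv; rewrite -[u]scale1r -(mpolyC1 2 K); apply: bp_lin. Qed.

Lemma bp_opp z (u : M) : bp_gr z u -> bp_gr z (- u).
Proof.
by move=> hu; rewrite -scaleN1r -(mpolyC1 2 K) -mpolyCN; apply: bp_scale.
Qed.

Lemma bp_sum z (I : Type) (r : seq I) (P : pred I) (f : I -> M) :
  (forall i, P i -> bp_gr z (f i)) -> bp_gr z (\sum_(i <- r | P i) f i).
Proof. by move=> h; elim/big_ind: _ => //; [apply: bp_zero|apply: bp_add]. Qed.

Lemma bp_xpow g z (v : M) : gle g z -> bp_gr g v -> bp_gr z (xpow K g z *: v).
Proof.
move=> gz hv; rewrite -[X in bp_gr X _](shift_expo gz) /shift expo0 expo1.
rewrite /xpow -scalerA; move: `|(z.1 - g.1)%R|%N `|(z.2 - g.2)%R|%N => a b /=.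
have hb : bp_gr (g.1, g.2 + b%:Z) (x2 K ^+ b *: v).
  elim: b => [|b IH]; first by rewrite expr0 scale1r addr0 -surjective_pairing.
  by rewrite exprS -scalerA intS (addrC 1) addrA; apply: (bp_x2 IH).
elim: a => [|a IH]; first by rewrite expr0 scale1r addr0.
by rewrite exprS -scalerA intS (addrC 1) addrA; apply: (bp_x1 IH).
Qed.

Section Family.
Variables (k : nat) (b : 'I_k -> M) (g : 'I_k -> grade).
Hypothesis b_gr : forall i, bp_gr (g i) (b i).

(** The element of grade [z] with coordinate vector [c]. *)
Definition comb z (c : 'cV[K]_k) : M :=
  \sum_(i | gle (g i) z) ((c i 0)%:MP * xpow K (g i) z) *: b i.

Lemma comb_gr z c : bp_gr z (comb z c).
Proof.
by apply: bp_sum => i gi; rewrite -scalerA; apply/bp_scale/bp_xpow.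
Qed.

Lemma comb_lin z a c d : comb z (a *: c + d) = a%:MP *: comb z c + comb z d.
Proof.
rewrite scaler_sumr -big_split; apply: eq_bigr => i _ /=.
by rewrite !mxE scalerA mulrA -mpolyCM -scalerDl -mulrDl -mpolyCD.
Qed.

Lemma comb0 z : comb z 0 = 0.
Proof. by apply: big1 => i _; rewrite mxE mpolyC0 mul0r scale0r. Qed.

Lemma comb_sum z (I : Type) (r : seq I) (P : pred I) (a : I -> K)
    (c : I -> 'cV[K]_k) :
  comb z (\sum_(t <- r | P t) a t *: c t) =
  \sum_(t <- r | P t) (a t)%:MP *: comb z (c t).
Proof.
elim: r => [|t r IH]; first by rewrite !big_nil comb0.
by rewrite !big_cons; case: (P t); rewrite ?comb_lin IH.
Qed.

Lemma comb_shift w z (c : 'cV[K]_k) : gle w z ->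
  (forall i, ~~ gle (g i) w -> c i 0 = 0) ->
  comb z c = xpow K w z *: comb w c.
Proof.
move=> wz c0; rewrite scaler_sumr [LHS]big_mkcond [RHS]big_mkcond /=.
apply: eq_bigr => i _.
have [giw|/c0 ->] := boolP (gle (g i) w); last first.
  by rewrite mpolyC0 mul0r scale0r; case: ifP.
by rewrite (gle_trans giw wz) scalerA -(xpow_trans giw wz) [in RHS]mulrC !mulrA.
Qed.

(** Sorting the monomials of the coefficients by the grade they lead to. The
    list [s0] makes sure that prescribed grades appear among the summands. *)
Lemma sum_comb (p : 'I_k -> {mpoly K[2]}) (s0 : seq grade) :
  exists s, [/\ uniq s, {subset s0 <= s} &
    \sum_i p i *: b i = \sum_(z <- s) comb z (\col_i gcoef (g i) z (p i))].
Proof.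
pose s := undup
  (s0 ++ flatten [seq [seq shift (g i) u | u <- msupp (p i)] | i <- enum 'I_k]).
exists s; split; first exact: undup_uniq.
  by move=> z zs; rewrite mem_undup mem_cat zs.
under [RHS]eq_bigr do rewrite /comb big_mkcond.
rewrite exchange_big; apply: eq_bigr => i _ /=.
rewrite {1}(@sum_gpart (g i) (p i) s) ?undup_uniq //; last first.
  move=> z zi; rewrite mem_undup mem_cat; apply/orP; right.
  by apply/flatten_mapP; exists i; rewrite ?mem_enum.
rewrite scaler_suml; apply: eq_bigr => z _; rewrite mxE /gpart.
by case: ifP => // ng; rewrite /gcoef ng mpolyC0 mul0r scale0r.
Qed.

(** By directness, a homogeneous combination equals its own component, so the
    polynomial coefficients may be replaced by scalars times monomials. *)
Lemma homogeneous_sum z (p : 'I_k -> {mpoly K[2]}) :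
  bp_gr z (\sum_i p i *: b i) ->
  \sum_i p i *: b i = comb z (\col_i gcoef (g i) z (p i)).
Proof.
set v := \sum_i _ => hv; have [s [us /(_ z (mem_head _ _)) zs e]] := sum_comb p [:: z].
pose f w := comb w (\col_i gcoef (g i) w (p i)) - (if w == z then v else 0).
have f_gr w : bp_gr w (f w).
  apply: bp_add; first exact: comb_gr.
  by apply: bp_opp; case: eqP => [->//|_]; apply: bp_zero.
have sf0 : \sum_(w <- s) f w = 0.
  rewrite big_split /= -e sumrN (bigD1_seq z) //= eqxx.
  by rewrite [X in _ - (_ + X)]big1 ?addr0 ?subrr // => w /negPf ->.
by move: (bp_direct us f_gr sf0 zs); rewrite /f eqxx => /eqP; rewrite subr_eq0 => /eqP.
Qed.

End Family.

Definition independent k (b : 'I_k -> M) : Prop :=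
  forall p : 'I_k -> {mpoly K[2]}, \sum_i p i *: b i = 0 -> forall i, p i = 0.

(** Minimality kills the constant coefficients of all relations: a relation with
    a nonzero constant coefficient at [j] has a component of grade [g j] that
    expresses [b j] through the other generators. *)
Lemma relation_const0 k (b : 'I_k -> M) (g : 'I_k -> grade)
    (p : 'I_k -> {mpoly K[2]}) :
  is_basis (fun _ : M => True) b g -> \sum_i p i *: b i = 0 ->
  forall j, (p j)@_0%MM = 0.
Proof.
move=> [_ b_gr gen_b min_b] p0 j; apply/eqP/negP => /negP pj.
have := @homogeneous_sum k b g b_gr (g j) p; rewrite p0 => /(_ (bp_zero _ _)).
rewrite /comb (bigD1 j) ?gle_refl //= xpow_refl mulr1 mxE /gcoef gle_refl.
have -> : expo (g j) (g j) = 0%MM by apply: mnm2P; rewrite ?expo0 ?expo1 subrr mnm0E.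
set c := (p j)@_0 in pj *; set r := \sum_(i | _) _ => /esym e.
have [q bj] : exists q : 'I_k -> {mpoly K[2]}, b j = \sum_(i in [set~ j]) q i *: b i.
  exists (fun i => if gle (g i) (g j) then - c^-1%:MP *
           ((gcoef (g i) (g j) (p i))%:MP * xpow K (g i) (g j)) else 0).
  have -> : b j = - c^-1%:MP *: r.
    have cbj : c%:MP *: b j = - r by apply/eqP; rewrite -addr_eq0 e.
    by rewrite scaleNr -scalerN -cbj scalerA -mpolyCM mulVf // mpolyC1 scale1r.
  rewrite scaler_sumr (eq_bigl (fun i => (i \in [set~ j]) && gle (g i) (g j))).
    rewrite big_mkcondr; apply: eq_bigr => i _.
    by case: ifP; rewrite ?scale0r // mxE scalerA.
  by move=> i; rewrite !inE andbC.
apply: (min_b [set~ j]).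
  by rewrite properT; apply/eqP => /setP /(_ j); rewrite !inE eqxx.
move=> v; split=> // _; have [a ->] := (gen_b v).1 I.
exists (fun i => a i + a j * q i).
rewrite (bigD1 j) ?inE //= {1}bj scaler_sumr.
under [RHS]eq_bigr do rewrite scalerDl -scalerA.
rewrite big_split /= addrC; congr (_ + _).
by apply: eq_bigl => i; rewrite !inE.
Qed.

Lemma generatesT (U : M -> Prop) k (b : 'I_k -> M) :
  generates U b setT <->
  forall v, U v <-> exists p : 'I_k -> {mpoly K[2]}, v = \sum_i p i *: b i.
Proof.
have sumT (p : 'I_k -> {mpoly K[2]}) :
    \sum_(i in setT) p i *: b i = \sum_i p i *: b i.
  by apply: eq_bigl => i; rewrite inE.
by split=> gen v; rewrite gen; split=> -[p ->]; exists p; rewrite ?sumT.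
Qed.

(** Let [PM] express a free family through [b] and [NM] express [b] through the
    free family. Then [PM *m NM = 1] by freeness, and the rows of
    [1 - NM *m PM] are relations of [b], which have no constant coefficient. Hence
    [NM *m PM = 1] at the origin, which forces both families to have the same
    size; then [NM *m PM = 1] already over the polynomial ring, and a relation
    [p] of [b] satisfies [p = p *m NM *m PM = 0]. *)
Theorem basis_independent k (b : 'I_k -> M) (g : 'I_k -> grade) :
  is_basis (fun _ : M => True) b g -> independent b.
Proof.
move=> b_basis; have [[k' [h [f [_ f_inj f_surj]]]] _ /generatesT gen _] := b_basis.
have /fin_all_exists[P fP] (i : 'I_k') : exists p : 'I_k -> {mpoly K[2]},
    f (delta_mx 0 i) = \sum_j p j *: b j.
  exact/gen.
have /fin_all_exists[N fN] (j : 'I_k) : exists w : 'rV_k', f w = b j.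
  exact/f_surj.
pose PM := \matrix_(i, j) P i j; pose NM := \matrix_(j, i) N j 0 i.
have f_comb (q : 'I_k -> {mpoly K[2]}) :
    f (\sum_j q j *: N j) = \sum_j q j *: b j.
  by rewrite linear_sum; apply: eq_bigr => j _; rewrite linearZ fN.
have f_row (w : 'rV_k') : f w = \sum_i w 0 i *: f (delta_mx 0 i).
  rewrite {1}[w]row_sum_delta linear_sum; apply: eq_bigr => i _.
  by rewrite linearZ.
have PN : PM *m NM = 1%:M.
  apply/matrixP => i l; rewrite !mxE; under eq_bigr do rewrite !mxE.
  have /f_inj/rowP/(_ l) := etrans (fP i) (esym (f_comb (P i))).
  rewrite mxE eqxx /= eq_sym => ->; rewrite summxE.
  by apply: eq_bigr => j _; rewrite mxE.
have NP_const : map_mx (mcoeff 0%MM) NM *m map_mx (mcoeff 0%MM) PM = 1%:M.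
  have q0 j : \sum_l ((j == l)%:R - (NM *m PM) j l) *: b l = 0.
    under eq_bigr do rewrite scalerBl.
    rewrite sumrB (bigD1 j) //= eqxx scale1r big1 ?addr0 => [|i /negPf ij]; last first.
      by rewrite eq_sym ij scale0r.
    apply/eqP; rewrite subr_eq0 -{1}fN f_row; apply/eqP.
    transitivity (\sum_i \sum_l N j 0 i *: (P i l *: b l)).
      by apply: eq_bigr => i _; rewrite fP scaler_sumr.
    rewrite exchange_big; apply: eq_bigr => i _ /=; rewrite mxE scaler_suml.
    by apply: eq_bigr => r _; rewrite !mxE scalerA.
  rewrite -map_mxM; apply/matrixP => j l; apply/eqP.
  have /= /eqP := relation_const0 b_basis (q0 j) l.
  rewrite mcoeffB subr_eq0 eq_sym !mxE => /eqP ->.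
  by case: (j == l); rewrite ?mcoeff1 ?eqxx ?mcoeff0.
(* The two sizes agree, so that [PM] and [NM] are square. *)
have kk' : k' = k.
  apply/eqP; rewrite eqn_leq (mulmx1_min PN) (mulmx1_min NP_const) //.
subst k'; have NP := mulmx1C PN.
move=> p p0; have pN0 : \sum_j p j *: N j = 0.
  by apply: f_inj; rewrite f_comb p0 linear0.
suff /rowP pz : \row_j p j = 0 by move=> i; have := pz i; rewrite !mxE.
rewrite -[LHS]mulmx1 -NP mulmxA [X in X *m _](_ : _ = 0) ?mul0mx //.
apply/rowP => i; have /rowP/(_ i) := pN0; rewrite !mxE summxE => e.
by rewrite -[RHS]e; apply: eq_bigr => j _; rewrite !mxE.
Qed.

Definition lincomb k (b : 'I_k -> M) (w : 'rV[{mpoly K[2]}]_k) : M :=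
  \sum_i w 0 i *: b i.

Fact lincomb_linear k (b : 'I_k -> M) : linear (lincomb b).
Proof.
move=> a u v; rewrite scaler_sumr -big_split; apply: eq_bigr => i _ /=.
by rewrite !mxE scalerA -scalerDl.
Qed.

HB.instance Definition _ k (b : 'I_k -> M) :=
  GRing.isLinear.Build {mpoly K[2]} 'rV[{mpoly K[2]}]_k M _ (lincomb b)
    (lincomb_linear b).

(** Independence yields both the isomorphism with a free module and minimality:
    a generator expressed through the others would be a relation with
    coefficient 1. *)
Theorem independent_basis (U : M -> Prop) k (b : 'I_k -> M) (g : 'I_k -> grade) :
  (forall i, bp_gr (g i) (b i)) ->
  (forall v, U v <-> exists p : 'I_k -> {mpoly K[2]}, v = \sum_i p i *: b i) ->
  independent b -> is_basis U b g.
Proof.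
move=> b_gr gen b_ind; split=> //; last 1 first.
- move=> D /properP[_ [j _ jD]] genD.
  have /genD[p bj] : U (b j).
    apply/gen; exists (fun i => (i == j)%:R).
    rewrite (bigD1 j) //= eqxx scale1r big1 ?addr0 // => i /negPf ->.
    by rewrite scale0r.
  have := b_ind (fun i => (i == j)%:R - if i \in D then p i else 0).
  rewrite /= (eq_bigr (fun i => (i == j)%:R *: b i -
    if i \in D then p i *: b i else 0)) => [|i _]; last first.
    by rewrite scalerBl; case: ifP; rewrite ?scale0r.
  rewrite sumrB -big_mkcond -bj (bigD1 j) //= eqxx scale1r big1 ?addr0 => [|i /negPf ->].
    by rewrite subrr => /(_ erefl j)/eqP; rewrite eqxx (negPf jD) subr0 oner_eq0.
  by rewrite scale0r.
- exists k, g, (lincomb b : {linear free_module K g -> M}); split.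
  + move=> z w hw; apply: bp_sum => i _; have [c ->] := hw i.
    case: ifP => gi; last by rewrite scale0r; apply: bp_zero.
    by rewrite -mul_mpolyC -scalerA; apply/bp_scale/bp_xpow.
  + move=> u v /eqP; rewrite -subr_eq0 -linearB => /eqP/b_ind uv0.
    by apply/rowP => i; apply/eqP; rewrite -subr_eq0; have := uv0 i; rewrite !mxE => ->.
  + move=> v; rewrite gen; split=> [[p ->]|[w <-]]; last by exists (fun i => w 0 i).
    by exists (\row_i p i); apply: eq_bigr => i _; rewrite mxE.
- exact/generatesT.
Qed.

End Module.
End Graded.

(** * From vectors of coordinates to a basis of the kernel *)

Definition supported n (g : 'I_n -> grade) (K : fieldType) (z : grade)
    (c : 'cV[K]_n) : Prop :=
  forall i, ~~ gle (g i) z -> c i 0 = 0.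

(** What a list of graded coordinate vectors must satisfy to represent a basis of
    the kernel. Only linear algebra over the field is involved, because it is
    asked for at every grade separately. *)
Record kernel_spec (K : fieldType) m n (A : bigraded_matrix K m n)
    (out : seq ('cV[K]_n * grade)) : Prop := KernelSpec {
  spec_free : free (unzip1 out);
  spec_kernel : forall p, p \in out -> A *m p.1 = 0 /\ supported (bg_gr A) p.2 p.1;
  spec_span : forall z c, A *m c = 0 -> supported (bg_gr A) z c ->
    c \in <<[seq p.1 | p <- out & gle p.2 z]>>%VS
}.

Section Kernel.
Variables (K : fieldType) (F F' : bipersistence K) (gamma : {linear F -> F'}).
Variables (m n : nat) (A : bigraded_matrix K m n).
Variables (B : 'I_n -> F) (B' : 'I_m -> F') (g' : 'I_m -> grade).
Hypothesis gamma_gr : grade_preserving gamma.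
Hypothesis B_basis : is_basis (fun _ : F => True) B (bg_gr A).
Hypothesis B'_basis : is_basis (fun _ : F' => True) B' g'.
Hypothesis A_gamma : represents gamma B B' g' A.
Local Notation g := (bg_gr A).

Let B_gr i : bp_gr (g i) (B i). Proof. by case: B_basis. Qed.

(** Independence over the polynomial ring gives uniqueness of coordinates in
    each grade. *)
Lemma comb_eq0 (M : bipersistence K) k (b : 'I_k -> M) h z (c : 'cV[K]_k) :
  independent b -> supported h z c -> comb b h z c = 0 -> c = 0.
Proof.
move=> b_ind c_supp; rewrite /comb big_mkcond /=.
rewrite (eq_bigr (fun i => (if gle (h i) z then (c i 0)%:MP * xpow K (h i) z
   else 0) *: b i)) => [/b_ind c0|i _]; last by case: ifP; rewrite ?scale0r.
apply/colP => i; rewrite mxE; have := c0 i; have [hi|/c_supp //] := boolP (gle _ _).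
move=> /(congr1 (mcoeff (expo (h i) z))); rewrite xpow_expo mcoeff0.
by rewrite mul_mpolyC mcoeffZ mcoeffX eqxx mulr1.
Qed.

Lemma A_supp i j : ~~ gle (g' i) (g j) -> A i j = 0.
Proof. by case: (A_gamma j) => _ h _ /h; rewrite mxE. Qed.

Lemma supported_mul z c : supported g z c -> supported g' z (A *m c).
Proof.
move=> c_supp i iz; rewrite mxE big1 // => j _.
have [/A_supp ->|ij] := boolP (~~ gle (g' i) (g j)); first by rewrite mul0r.
rewrite c_supp ?mulr0 //; apply: contra iz => jz.
by apply: gle_trans jz; rewrite negbK in ij.
Qed.

(** In every grade, [gamma] acts on coordinates by the one matrix [A]. *)
Lemma gamma_comb z c : supported g z c ->
  gamma (comb B g z c) = comb B' g' z (A *m c).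
Proof.
move=> c_supp; rewrite linear_sum /=.
transitivity (\sum_(j | gle (g j) z) \sum_(i | gle (g' i) z)
   ((A i j * c j 0)%:MP * xpow K (g' i) z) *: B' i).
  apply: eq_bigr => j jz; rewrite linearZ /=; have [_ _ ->] := A_gamma j.
  rewrite scaler_sumr [LHS]big_mkcond [RHS]big_mkcond /=; apply: eq_bigr => i _.
  have [ij|/A_supp ->] := boolP (gle (g' i) (g j)); last first.
    by rewrite mul0r mpolyC0 mul0r scale0r; case: ifP.
  rewrite (gle_trans ij jz) scalerA mxE -(xpow_trans _ ij jz) mpolyCM.
  by congr (_ *: _); rewrite mulrACA; congr (_ * _); rewrite mulrC.
rewrite exchange_big; apply: eq_bigr => i iz /=.
rewrite mxE raddf_sum /= mulr_suml scaler_suml big_mkcond; apply: eq_bigr => j _.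
by case: ifP => // /negbT /c_supp ->; rewrite mulr0 mpolyC0 mul0r scale0r.
Qed.

Lemma gamma_comb_eq0 z c : supported g z c ->
  gamma (comb B g z c) = 0 <-> A *m c = 0.
Proof.
move=> c_supp; rewrite gamma_comb //; split=> [|->]; last exact: comb0.
by apply: comb_eq0; [apply: basis_independent B'_basis|apply: supported_mul].
Qed.

Section Output.
Variable out : seq ('cV[K]_n * grade).
Hypothesis out_spec : kernel_spec A out.

Let V (t : 'I_(size out)) : 'cV[K]_n := (tnth (in_tuple out) t).1.
Let h (t : 'I_(size out)) : grade := (tnth (in_tuple out) t).2.
Let b (t : 'I_(size out)) : F := comb B g (h t) (V t).

Let V_spec t : A *m V t = 0 /\ supported g (h t) (V t).
Proof. exact/(spec_kernel out_spec)/(mem_tnth t (in_tuple out)). Qed.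

Let b_gr t : bp_gr (h t) (b t). Proof. exact: comb_gr. Qed.

(** A combination of output elements has the same combination of output vectors
    as coordinates, since raising the grade leaves coordinates unchanged. *)
Lemma output_comb z (a : 'cV[K]_(size out)) :
  comb b h z a = comb B g z (\sum_(t | gle (h t) z) a t 0 *: V t).
Proof.
rewrite comb_sum; apply: eq_bigr => t tz.
by rewrite (comb_shift _ tz) ?scalerA //; case: (V_spec t).
Qed.

Lemma supported_sum z (I : finType) (P : pred I) (a : I -> K) (c : I -> 'cV[K]_n) :
  (forall t, P t -> supported g z (c t)) ->
  supported g z (\sum_(t | P t) a t *: c t).
Proof.
move=> c_supp i iz; rewrite summxE big1 // => t Pt.
by rewrite mxE c_supp ?mulr0.
Qed.

Lemma supported_le w z (c : 'cV[K]_n) : gle w z -> supported g w c -> supported g z c.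
Proof. by move=> wz c_supp i iz; apply/c_supp/(contra _ iz) => /gle_trans; apply. Qed.

(** A coefficient of a relation is read off in the grade that its monomial leads
    to, where it is a coefficient of a linear relation between output vectors. *)
Lemma output_independent : independent b.
Proof.
move=> p p0 t; apply/mpolyP => u; rewrite mcoeff0.
pose z := shift (h t) u; have := homogeneous_sum b_gr (z := z) (p := p).
rewrite p0 => /(_ (bp_zero _ _))/esym; rewrite output_comb => comb0.
have {comb0} := comb_eq0 (basis_independent B_basis) _ comb0.
have supp : forall s, gle (h s) z -> supported g z (V s).
  by move=> s sz; apply: supported_le sz _; case: (V_spec s).
move/(_ (supported_sum _ supp)).
have /(@freeP _ _ _ (map_tuple fst (in_tuple out))) free_V := spec_free out_spec.
rewrite big_mkcond /=.
rewrite (eq_bigr (fun s => (if gle (h s) z then gcoef (h s) z (p s) else 0) *: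
    (map_tuple fst (in_tuple out))`_s)) => [sum0|s _].
  by have /= := free_V _ sum0 t; rewrite gle_shift /gcoef gle_shift expo_shift.
by rewrite -tnth_nth tnth_map mxE; case: ifP; rewrite ?scale0r.
Qed.

(** The homogeneous components of a kernel element are in the kernel, because
    [gamma] preserves grades and the sum over grades is direct; each of them is a
    combination of output elements by [spec_span]. *)
Lemma output_generates v :
  gamma v = 0 <-> exists p : 'I_(size out) -> {mpoly K[2]}, v = \sum_t p t *: b t.
Proof.
split=> [v0|[p ->]]; last first.
  rewrite linear_sum big1 // => t _; rewrite linearZ /=.
  by case: (V_spec t) => Vt /gamma_comb_eq0[_ ->] //; rewrite scaler0.
have [_ _ /generatesT gen _] := B_basis; have [p vE] := (gen v).1 I.
have [s [us _ e]] := sum_comb B g p [::].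
rewrite {}vE {}e in v0 *; pose c z : 'cV[K]_n := \col_i gcoef (g i) z (p i).
have c_supp z : supported g z (c z).
  by move=> i /negPf iz; rewrite mxE /gcoef iz.
have part0 z : z \in s -> A *m c z = 0.
  move=> zs; apply/gamma_comb_eq0 => //; rewrite linear_sum in v0.
  by apply: (bp_direct us _ v0) => // w; apply/gamma_gr/comb_gr.
have {v0}span z : z \in s -> exists q : 'I_(size out) -> {mpoly K[2]},
    comb B g z (c z) = \sum_t q t *: b t.
  move=> /part0 /(spec_span out_spec)/(_ (c_supp z)).
  have /subvP sub : (<<[seq p.1 | p <- out & gle p.2 z]>> <=
      \sum_(t | gle (h t) z) <[V t]>)%VS.
    apply/span_subvP => x /mapP[y]; rewrite mem_filter => /andP[yz yo] ->.
    have /tnthP[t yt] : y \in in_tuple out by [].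
    rewrite yt in yz *.
    by apply: (subvP (sumv_sup t yz (subvv _))); apply: memv_line.
  move/sub/memv_sumP => [vs vsV ->].
  have /fin_all_exists[a vsE] t : exists a : K, gle (h t) z -> vs t = a *: V t.
    case: (boolP (gle (h t) z)) => [tz|_]; last by exists 0.
    by have /vlineP[a] := vsV t tz; exists a.
  have -> : \sum_(t | gle (h t) z) vs t =
      \sum_(t | gle (h t) z) (\col_t a t) t 0 *: V t.
    by apply: eq_bigr => t tz; rewrite mxE vsE.
  rewrite -output_comb /comb big_mkcond.
  exists (fun t => if gle (h t) z then (a t)%:MP * xpow K (h t) z else 0).
  by apply: eq_bigr => t _; case: ifP; rewrite ?scale0r ?mxE.
elim: s {us part0} span => [|z s IH] span.
  by exists (fun=> 0); rewrite big_nil big1 // => t _; rewrite scale0r.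
have [q qE] := span z (mem_head _ _).
have [|r rE] := IH; first by move=> w ws; apply: span; rewrite inE ws orbT.
exists (fun t => q t + r t); rewrite big_cons rE (qE : comb _ _ _ _ = _) -big_split.
by apply: eq_bigr => t _; rewrite scalerDl.
Qed.

Theorem kernel_spec_basis : exists b : 'I_(size out) -> F,
  (forall t, coordinates B g (h t) (b t) (V t)) /\
  is_basis (fun v : F => gamma v = 0) b h.
Proof.
exists b; split=> [t|]; first by split=> //; case: (V_spec t).
by apply: independent_basis => //; [apply: output_generates|apply: output_independent].
Qed.

End Output.
End Kernel.

(** * Pivots and column operations *)

Section Pivots.
Variables (K : fieldType) (m n : nat).
Implicit Types R : 'M[K]_(m, n).

Lemma pivotP R j l : pivot R j = Some l <->
  R l j != 0 /\ forall i : 'I_m, (l < i)%N -> R i j = 0.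
Proof.
rewrite /pivot; case: pickP => [i /andP[Ri /forallP maxi]|none]; split=> //.
- case=> <-; split=> // a ia; by apply/eqP; move: (maxi a); rewrite ia.
- case=> Rl maxl; congr Some; apply/val_inj/eqP => /=.
  rewrite eqn_leq; apply/andP; split; rewrite leqNgt; apply/negP => lt.
    by rewrite maxl ?eqxx // in Ri.
  by move: (maxi l); rewrite lt (negPf Rl).
- case=> Rl maxl; have := none l; rewrite Rl /= => /negbT/forallPn[i].
  by rewrite negb_imply => /andP[li]; rewrite maxl ?eqxx.
Qed.

Lemma pivot_nullP R j : pivot R j = None <-> forall i, R i j = 0.
Proof.
split=> [e i|z]; last first.
  by rewrite /pivot; case: pickP => // i /andP[]; rewrite z eqxx.
apply/eqP/negP => /negP Ri.
pose l := [arg max_(l > i | R l j != 0) (l : nat)].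
suff : pivot R j = Some l by rewrite e.
rewrite /l; case: arg_maxnP => // a Ra maxa; apply/pivotP; split=> // b ab.
by apply/eqP/negP => /negP /maxa; rewrite /= leqNgt ab.
Qed.

Lemma eq_pivot R R' j k : (forall i, R i j = R' i k) -> pivot R j = pivot R' k.
Proof.
move=> e; case E: (pivot R' k) => [l|].
  by move/pivotP: E => [Rl maxl]; apply/pivotP; rewrite e; split=> // i /maxl <-.
by move/pivot_nullP: E => E; apply/pivot_nullP => i; rewrite e.
Qed.

(** Unlike [pivot], this puts null columns below all others. *)
Definition height R (j : 'I_n) : nat := if pivot R j is Some l then l.+1 else 0%N.

Lemma height_le R j t : (forall i : 'I_m, (t <= i)%N -> R i j = 0) -> (height R j <= t)%N.
Proof.
move=> R0; rewrite /height; case E: (pivot R j) => [l|//].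
by move/pivotP: E => [Rl _]; rewrite ltnNge; apply: contra Rl => /R0 ->.
Qed.

Lemma eq_height R R' j k : (forall i, R i j = R' i k) -> height R j = height R' k.
Proof. by move=> e; rewrite /height (eq_pivot e). Qed.

Lemma add_col_neq r c (k j l : 'I_n) (M : 'M[K]_(r, n)) i : l != j ->
  add_col c k j M i l = M i l.
Proof. by move=> /negPf lj; rewrite mxE lj. Qed.

Lemma add_col_eq r c (k j : 'I_n) (M : 'M[K]_(r, n)) i :
  add_col c k j M i j = M i j + c * M i k.
Proof. by rewrite mxE eqxx. Qed.

Lemma mul_add_col r c (k j : 'I_n) (A : 'M[K]_(r, n)) (V : 'M[K]_n) :
  A *m add_col c k j V = add_col c k j (A *m V).
Proof.
apply/matrixP => i l; rewrite !mxE; case: eqP => [->|/eqP lj]; last first.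
  by apply: eq_bigr => a _; rewrite add_col_neq.
rewrite mulr_sumr -big_split; apply: eq_bigr => a _ /=.
by rewrite add_col_eq mulrDr mulrCA.
Qed.

(** The entries at the common pivot cancel, and both columns vanish below it. *)
Lemma height_add_col R (k j : 'I_n) l : k != j ->
  pivot R j = Some l -> pivot R k = Some l ->
  (height (add_col (- (R l j / R l k)) k j R) j <= l)%N.
Proof.
move=> kj /pivotP[_ maxj] /pivotP[Rk maxk]; apply: height_le => i.
rewrite leq_eqVlt add_col_eq => /orP[/eqP/val_inj <-|li].
  by rewrite mulNr divfK ?subrr.
by rewrite maxj // (maxk i) // mulr0 addr0.
Qed.

Section Slack.
Variable A : 'M[K]_(m, n).

Definition lower t : 'M[K]_(m, n) := \matrix_(i, j) if (t <= i)%N then A i j else 0.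

Lemma lower_mul t (c : 'cV[K]_n) i :
  (lower t *m c) i 0 = if (t <= i)%N then (A *m c) i 0 else 0.
Proof.
rewrite !mxE; case: ifP => ti; last by rewrite big1 // => a _; rewrite mxE ti mul0r.
by apply: eq_bigr => a _; rewrite mxE ti.
Qed.

Lemma lower_sub s t : (s <= t)%N -> (lower t <= lower s)%MS.
Proof.
move=> st; apply/row_subP => i; have [ti|ti] := leqP t i; last first.
  suff -> : row i (lower t) = 0 by apply: sub0mx.
  by apply/rowP => j; rewrite !mxE leqNgt ti.
suff -> : row i (lower t) = row i (lower s) by apply: row_sub.
by apply/rowP => j; rewrite !mxE ti (leq_trans st ti).
Qed.

Lemma lower0 : lower 0 = A.
Proof. by apply/matrixP => i j; rewrite mxE. Qed.

(** This counts the indices below [t] that are pivots of vectors in the column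
    space of [A]. Ranks of trailing rows give this number without exhibiting such
    vectors. *)
Definition slack t : nat := (\rank A - \rank (lower t))%N.

Lemma slack_max t : (slack t <= minn m n)%N.
Proof. by rewrite (leq_trans (leq_subr _ _)) // leq_min rank_leq_row rank_leq_col. Qed.

(** A vector [A *m c] with pivot [l] shows that row [l] is not a combination of the
    rows below it, since [c] annihilates those but not row [l]. *)
Lemma slack_lt (c : 'cV[K]_n) (l : 'I_m) t : (A *m c) l 0 != 0 ->
  (forall i : 'I_m, (l < i)%N -> (A *m c) i 0 = 0) -> (t <= l)%N ->
  (slack t < slack l.+1)%N.
Proof.
move=> cl maxl tl; suff lt : (\rank (lower l.+1) < \rank (lower t))%N.
  apply: ltn_sub2l (lt); apply: leq_trans lt _.
  by rewrite -[X in (_ <= \rank X)%N]lower0; apply/mxrankS/lower_sub.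
apply: rank_ltmx; rewrite ltmxE lower_sub ?(leq_trans tl) //=.
apply: contra cl => /submxP[D e].
have : (lower t *m c) l 0 = 0.
  rewrite e -mulmxA; suff -> : lower l.+1 *m c = 0 by rewrite mulmx0 mxE.
  by apply/colP => i; rewrite lower_mul [RHS]mxE; case: ifP => // /maxl.
by rewrite lower_mul tl => ->.
Qed.

End Slack.
End Pivots.

(** * The invariant of the sweep *)

Section Sweep.
Variables (K : fieldType) (m n : nat) (A : bigraded_matrix K m n).
Local Notation gr := (bg_gr A).
Local Notation output := (seq ('cV[K]_n * grade)).
Implicit Types (d : data K m n) (x : int) (O : output).

(** The invariant during the pass for first coordinate [x]: the columns of index
    below [b] have been reduced in this pass, those below [e] have also been
    checked for output, and [O] is the output before the pass. Only columns that
    occur in [d_pivs], hence have been visited, are ever added to others; this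
    keeps the entries off the diagonal of [V] in rows with label up to [x]. An
    entry of [d_pivs] always holds a column with that pivot, but a nonzero column
    may be missing from [d_pivs] until it is visited again, because a column of
    smaller index with the same pivot has replaced it. *)
Record sweep_inv x (b e : nat) O d : Prop := Inv {
  inv_R : d_R d = A *m d_V d;
  inv_diag : forall j : 'I_n, d_V d j j = 1;
  inv_upper : forall i j : 'I_n, d_V d i j != 0 -> (i <= j)%N;
  inv_supp : forall i j : 'I_n, d_V d i j != 0 -> i = j \/ (gr i).1 <= x;
  inv_pivs : forall (l : 'I_m) (k : 'I_n), d_pivs d l = Some k ->
    pivot (d_R d) k = Some l /\ (gr k).1 <= x;
  inv_found : forall j : 'I_n, d_found d j -> pivot (d_R d) j = None /\
    exists2 t, t <= x & (col j (d_V d), (t, (gr j).2)) \in d_out d;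
  inv_out : exists js, [/\ uniq js, forall j, d_found d j = (j \in js) &
    unzip1 (d_out d) = [seq col j (d_V d) | j <- js]];
  inv_kernel : forall p, p \in d_out d -> A *m p.1 = 0 /\ supported gr p.2 p.1;
  inv_grow : {subset O <= d_out d};
  inv_order : (e <= b)%N;
  inv_reduced : forall (k : 'I_n) l, (k < b)%N -> (gr k).1 <= x ->
    pivot (d_R d) k = Some l -> d_pivs d l = Some k;
  inv_recorded : forall k : 'I_n, (k < e)%N -> (gr k).1 <= x ->
    pivot (d_R d) k = None -> d_found d k
}.

(** Passing to a larger [x] brings new columns into play, so nothing counts as
    reduced or checked. *)
Lemma inv_restart x x' b e O d : x <= x' -> sweep_inv x b e O d ->
  sweep_inv x' 0 0 (d_out d) d.
Proof.
move=> xx' [h1 h2 h3 h4 h5 h6 h7 h8 h9 h10 h11 h12]; split=> //.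
- by move=> i j /h4[->|ix]; [left|right; apply: le_trans xx'].
- by move=> l k /h5[? kx]; split=> //; apply: le_trans xx'.
- by move=> j /h6[? [t tx ?]]; split=> //; exists t => //; apply: le_trans xx'.
Qed.

Lemma inv_skip x b b' e O d : sweep_inv x b e O d -> (b <= b')%N ->
  (forall k : 'I_n, (b <= k < b')%N -> (gr k).1 <= x -> forall l,
     pivot (d_R d) k = Some l -> d_pivs d l = Some k) ->
  sweep_inv x b' e O d.
Proof.
move=> [h1 h2 h3 h4 h5 h6 h7 h8 h9 h10 h11 h12] bb' hb; split=> //.
  exact: leq_trans bb'.
move=> k l kb'; case: (ltnP k b) => [kb|bk]; first exact: h11.
by move=> kx; apply: hb; rewrite ?bk.
Qed.

Lemma inv_skip_record x b e e' O d : sweep_inv x b e O d -> (e <= e' <= b)%N ->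
  (forall k : 'I_n, (e <= k < e')%N -> (gr k).1 <= x ->
     pivot (d_R d) k = None -> d_found d k) ->
  sweep_inv x b e' O d.
Proof.
move=> [h1 h2 h3 h4 h5 h6 h7 h8 h9 h10 h11 h12] /andP[_ e'b] he; split=> //.
by move=> k ke'; case: (ltnP k e) => [ke|ek]; [apply: h12|apply: he; rewrite ek].
Qed.

(** Entering [j] in [d_pivs] can only displace a column of larger index, which is
    not yet reduced in this pass. *)
Lemma inv_put_pivs x e O d (j : 'I_n) l : sweep_inv x j e O d -> (gr j).1 <= x ->
  pivot (d_R d) j = Some l ->
  (forall k, d_pivs d l = Some k -> (j < k)%N) ->
  sweep_inv x j.+1 e O (put_pivs l j d).
Proof.
move=> [h1 h2 h3 h4 h5 h6 h7 h8 h9 h10 h11 h12] jx jl free; split=> //=.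
- move=> l' k; rewrite ffunE; case: eqP => [->|_]; last exact: h5.
  by case=> <-.
- exact: leqW.
- move=> k l'; rewrite ltnS leq_eqVlt ffunE => /orP[/eqP/val_inj ->|kj] kx kl'.
    by move: kl'; rewrite jl => -[->]; rewrite eqxx.
  have kl := h11 _ _ kj kx kl'; case: eqP => // ll'.
  by move: (free k); rewrite -ll' => /(_ kl); rewrite ltnNge ltnW.
Qed.

Definition cancel_pivot l k j d : data K m n :=
  let c := - (d_R d l j / d_R d l k) in
  put_matrices (add_col c k j (d_R d)) (add_col c k j (d_V d)) d.

(** As [k] has been visited and precedes [j], the shape of [V] is preserved; as [j]
    is nonzero, it has not been output, so the output vectors are still columns
    of [V]. *)
Lemma inv_add x e O d (j k : 'I_n) l : sweep_inv x j e O d -> (gr j).1 <= x ->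
  pivot (d_R d) j = Some l -> d_pivs d l = Some k -> (k < j)%N ->
  sweep_inv x j e O (cancel_pivot l k j d).
Proof.
move=> [h1 h2 h3 h4 h5 h6 h7 h8 h9 h10 h11 h12] jx jl lk kj.
set c := - (d_R d l j / d_R d l k).
have [kl kx] := h5 _ _ lk.
have nkj : k != j by rewrite -val_eqE /= neq_ltn kj.
have pivN i : i != j -> pivot (add_col c k j (d_R d)) i = pivot (d_R d) i.
  by move=> ij; apply: eq_pivot => a; rewrite add_col_neq.
have colN i : i != j -> col i (add_col c k j (d_V d)) = col i (d_V d).
  by move=> ij; apply/colP => a; rewrite !mxE (negPf ij).
have foundN i : d_found d i -> i != j.
  by move=> /h6[iN _]; apply/eqP => ij; rewrite ij jl in iN.
have entry i : add_col c k j (d_V d) i j != 0 -> d_V d i j != 0 \/ d_V d i k != 0.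
  rewrite add_col_eq => ne; case: (eqVneq (d_V d i j) 0) => [z|]; last by left.
  right; apply: contra ne => /eqP ->; by rewrite z mulr0 addr0.
split=> //=.
- by rewrite h1 -mul_add_col.
- move=> i; have [->|ij] := eqVneq i j; last by rewrite add_col_neq.
  rewrite add_col_eq h2; have [->|/h3] := eqVneq (d_V d j k) 0.
    by rewrite mulr0 addr0.
  by rewrite leqNgt kj.
- move=> i i'; have [->|ij] := eqVneq i' j; last by rewrite add_col_neq //; apply: h3.
  by move=> /entry[/h3 //|/h3 ik]; apply: leq_trans ik (ltnW kj).
- move=> i i'; have [->|ij] := eqVneq i' j; last by rewrite add_col_neq //; apply: h4.
  by move=> /entry[/h4 //|/h4[->|]]; right.
- move=> l' k' l'k'; have [k'l' k'x] := h5 _ _ l'k'; rewrite pivN //.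
  apply/eqP => k'j; move: k'l'; rewrite k'j jl => -[ll'].
  by move: l'k'; rewrite -ll' lk k'j => -[/eqP]; rewrite (negPf nkj).
- by move=> i fi; have [iN out_i] := h6 i fi; rewrite pivN ?colN ?foundN.
- have [js [ujs fjs e_out]] := h7; exists js; split=> //; rewrite e_out.
  by apply/eq_in_map => i ijs; rewrite colN // foundN // fjs.
- move=> i l' ij ix; have nij : i != j by rewrite -val_eqE /= neq_ltn ij.
  by rewrite pivN //; apply: h11.
- move=> i ie ix; have nij : i != j.
    by rewrite -val_eqE /= neq_ltn (leq_trans ie).
  by rewrite pivN //; apply: h12.
Qed.

(** The entries of column [j] of [V] are in rows [i] with first coordinate at most
    [x] and with [i <= j], hence with second coordinate at most that of [j], by
    the colexicographical order of the labels. *)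
Lemma inv_record x b O d (j : 'I_n) : sweep_inv x b j O d -> (j < b)%N -> (gr j).1 <= x ->
  pivot (d_R d) j = None -> ~~ d_found d j ->
  sweep_inv x b j.+1 O (record_column j (x, (gr j).2) d).
Proof.
move=> [h1 h2 h3 h4 h5 h6 h7 h8 h9 h10 h11 h12] jb jx jN jf; split=> //=.
- move=> i; rewrite ffunE; case: eqP => [-> _|_ fi].
    by split=> //; exists x; rewrite // mem_rcons mem_head.
  have [iN [t tx ti]] := h6 i fi; split=> //; exists t => //.
  by rewrite mem_rcons inE ti orbT.
- have [js [ujs fjs e_out]] := h7; exists (rcons js j); split.
  + by rewrite rcons_uniq -fjs jf.
  + by move=> i; rewrite ffunE mem_rcons inE -fjs; case: eqP.
  + by rewrite /unzip1 !map_rcons /= -e_out.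
- move=> p; rewrite mem_rcons inE => /orP[/eqP -> /=|/h8 //]; split.
    rewrite colE mulmxA -h1 -colE; apply/colP => i; rewrite !mxE.
    by have /pivot_nullP -> := jN.
  move=> i; rewrite mxE => iz; apply/eqP; apply: contraNT iz => Vij.
  have /orP ij := @bg_colex _ _ _ A _ _ (h3 _ _ Vij); apply/andP; split=> /=.
    by case: (h4 _ _ Vij) => [->|].
  by case: ij => [/ltW //|/andP[/eqP -> _]].
- by move=> p /h9 p_out; rewrite mem_rcons inE p_out orbT.
- move=> k; rewrite ffunE ltnS leq_eqVlt => /orP[/eqP/val_inj ->|kj] kx kN.
    by rewrite eqxx.
  by case: eqP => // _; apply: h12.
Qed.

(** The part of [kernel_spec] that one pass establishes once and for all. *)
Definition complete x O : Prop := forall y (c : 'cV[K]_n),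
  A *m c = 0 -> supported gr (x, y) c ->
  c \in <<[seq p.1 | p <- O & gle p.2 (x, y)]>>%VS.

Lemma complete_grow x O O' : {subset O <= O'} -> complete x O -> complete x O'.
Proof.
move=> OO' OC y c Ac c_supp; move: (OC y c Ac c_supp); apply/subvP/sub_span => v.
move=> /mapP[p]; rewrite mem_filter => /andP[px pO] ->.
by apply: map_f; rewrite mem_filter px OO'.
Qed.

Lemma unitri_unit (V : 'M[K]_n) : (forall j, V j j = 1) ->
  (forall i j, V i j != 0 -> (i <= j)%N) -> V \in unitmx.
Proof.
move=> V1 V_upper; rewrite unitmxE -det_tr det_trig.
  by rewrite big1 ?unitr1 // => i _; rewrite mxE.
apply/is_trig_mxP => i j ij; rewrite mxE; apply/eqP; apply: contraTT ij.
by move/V_upper; rewrite -leqNgt.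
Qed.

Lemma ord_max_ex (k : nat) (P : pred 'I_k) i0 : P i0 ->
  exists2 i, P i & forall j : 'I_k, P j -> (j <= i)%N.
Proof.
by move=> P0; case: (@arg_maxnP _ i0 P (fun i => val i) P0) => i Pi maxi; exists i.
Qed.

(** In the row of the lowest pivot that occurs, a relation has a single nonzero
    term, which is impossible. *)
Lemma relation_null (R : 'M[K]_(m, n)) (a : 'cV[K]_n) : R *m a = 0 ->
  (forall j k l, a j 0 != 0 -> a k 0 != 0 ->
     pivot R j = Some l -> pivot R k = Some l -> j = k) ->
  forall j, a j 0 != 0 -> pivot R j = None.
Proof.
move=> Ra dist j aj; case jl: (pivot R j) => [l|//].
pose P (l : 'I_m) := [exists k, (a k 0 != 0) && (pivot R k == Some l)].
have Pl : P l by apply/existsP; exists j; rewrite aj jl eqxx.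
have [l' /existsP[k /andP[ak /eqP kl']] maxl'] := ord_max_ex Pl.
(* The column [k] is the only one involved that reaches down to row [l']. *)
have [Rk _] := (pivotP _ _ _).1 kl'.
have /colP/(_ l') := Ra; rewrite !mxE (bigD1 k) //= big1 ?addr0 => [/eqP|i ik].
  by rewrite mulf_eq0 (negPf Rk) (negPf ak).
have [->|ai] := eqVneq (a i 0) 0; first by rewrite mulr0.
case il: (pivot R i) => [l''|]; last by have /pivot_nullP -> := il; rewrite mul0r.
have [_ max_i] := (pivotP _ _ _).1 il.
have le : (l'' <= l')%N by apply: maxl'; apply/existsP; exists i; rewrite ai il eqxx.
move: le; rewrite leq_eqVlt => /orP[/eqP/val_inj e|lt]; last by rewrite max_i ?mul0r.
by rewrite (dist i k l') ?eqxx // ?il ?e // in ik.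
Qed.

(** Let [c = V *m a] be a kernel vector supported on labels below [(x, y)]. Then so
    is [a], by considering the last index that would contradict this. As
    [R *m a = 0] and the columns involved have distinct pivots, they are null,
    and null columns have been output at a grade below [(x, y)]. *)
Lemma inv_complete x O d : sweep_inv x n n O d -> complete x (d_out d).
Proof.
move=> [h1 h2 h3 h4 h5 h6 h7 h8 h9 h10 h11 h12] y c Ac c_supp.
pose V := d_V d; have V_unit : V \in unitmx by apply: unitri_unit.
pose a := invmx V *m c; have cE : c = V *m a by rewrite mulmxA mulmxV ?mul1mx.
have a_supp j : a j 0 != 0 -> gle (gr j) (x, y).
  move=> aj; case: (boolP (gle _ _)) => // jz.
  pose P j := (a j 0 != 0) && ~~ gle (gr j) (x, y).
  have Pj : P j by rewrite /P aj.
  have [i /andP[ai iz] maxi] := ord_max_ex Pj.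
  (* Only the diagonal term of row [i] of [V *m a] can be nonzero. *)
  have := c_supp i iz; rewrite cE mxE (bigD1 i) //= h2 mul1r.
  rewrite big1 ?addr0 => [/eqP|k ki]; first by rewrite (negPf ai).
  apply/eqP; rewrite mulf_eq0; apply/norP => -[Vik ak].
  have ik : (i < k)%N by rewrite ltn_neqAle h3 // andbT eq_sym.
  have kz : gle (gr k) (x, y).
    by apply: contraLR ik => kz; rewrite -leqNgt maxi // /P ak.
  case/negP: iz; apply/andP; split=> /=.
    by case: (h4 _ _ Vik) => // ik'; rewrite ik' eqxx in ki.
  have /andP[_ /= ky] := kz; apply: le_trans ky.
  by have /orP[/ltW|/andP[/eqP ->]] := @bg_colex _ _ _ A _ _ (ltnW ik).
have a_null j : a j 0 != 0 -> pivot (d_R d) j = None.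
  apply: relation_null => [|i k l /a_supp/andP[ix _] /a_supp/andP[kx _] il kl].
    by rewrite h1 -mulmxA -cE.
  have := h11 _ _ (ltn_ord i) ix il.
  by rewrite (h11 _ _ (ltn_ord k) kx kl) => -[].
have -> : c = \sum_j a j 0 *: col j V.
  by apply/colP => i; rewrite cE !mxE summxE; apply: eq_bigr => j _; rewrite !mxE mulrC.
apply: rpred_sum => j _; have [->|aj] := eqVneq (a j 0) 0.
  by rewrite scale0r rpred0.
have /andP[/= jx jy] := a_supp j aj.
have [_ [t tx tj]] := h6 j (h12 j (ltn_ord j) jx (a_null j aj)).
apply/rpredZ/memv_span/mapP; exists (col j V, (t, (gr j).2)) => //.
by rewrite mem_filter tj andbT; apply/andP.
Qed.

(** Outside the grid nothing happens: if [c] is supported on labels below [z] then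
    it is supported on labels below [(x, z.2)], where [x] is the largest first
    coordinate of the labels that occur in [c]. *)
Lemma inv_spec x b e O d : sweep_inv x b e O d ->
  (forall j, complete (gr j).1 (d_out d)) -> kernel_spec A (d_out d).
Proof.
move=> [h1 h2 h3 _ _ _ [js [ujs _ out_js]] h8 _ _ _ _] compl; split=> //.
- rewrite out_js; have V_unit := unitri_unit h2 h3.
  apply/(@freeP _ _ _ (map_tuple (fun j => col j (d_V d)) (in_tuple js))) => a a0 t.
  pose c : 'cV[K]_n := \sum_(s < size js) a s *: delta_mx (tnth (in_tuple js) s) 0.
  have Vc : d_V d *m c = 0.
    rewrite mulmx_sumr -[RHS]a0; apply: eq_bigr => s _.
    by rewrite -scalemxAr -tnth_nth tnth_map colE.
  have /colP/(_ (tnth (in_tuple js) t)) : c = 0.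
    by rewrite -[c]mul1mx -(mulVmx V_unit) -mulmxA Vc mulmx0.
  rewrite mxE summxE (bigD1 t) //= !mxE !eqxx mulr1 big1 ?addr0 // => s st.
  rewrite !mxE [_ == _](_ : _ = false) ?mulr0 //; apply/negbTE.
  by rewrite (inj_eq (tuple_uniqP (in_tuple js) ujs)) eq_sym (negPf st).
- move=> z c Ac c_supp; have [->|] := eqVneq c 0; first exact: mem0v.
  case/cV0Pn => i0 ci0.
  case: (@Order.TotalTheory.arg_maxP _ _ _ i0 (fun i => c i 0 != 0)
    (fun i => (gr i).1) ci0) => i ci maxi.
  have le_z : gle ((gr i).1, z.2) z.
    rewrite /gle lexx andbT /=; have : gle (gr i) z by apply: contraR ci => /c_supp ->.
    by case/andP.
  have : supported gr ((gr i).1, z.2) c.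
    move=> k; apply: contraNeq => ck; apply/andP; split; first exact: maxi.
    by have : gle (gr k) z by [apply: contraR ck => /c_supp ->]; case/andP.
  move/(compl i z.2 c Ac); apply/subvP/sub_span => v /mapP[p].
  rewrite mem_filter => /andP[pz pO] ->; apply: map_f.
  by rewrite mem_filter pO andbT; apply: gle_trans le_z.
Qed.

End Sweep.

(** * Cost of the sweep *)

Section Cost.
Variables (K : fieldType) (m n : nat) (A : bigraded_matrix K m n).
Local Notation gr := (bg_gr A).
Implicit Types (d : data K m n) (st : machine K m n).

(** Every future addition, including the 9 units of its tests, and every future
    output vector are paid for in advance. *)
Definition potential d : nat :=
  ((m + n + 9) * \sum_j slack A (height (d_R d) j) + (n + 2) * \sum_j ~~ d_found d j)%N.

Lemma potential_max d : (potential d <= (m + n + 9) * (n * minn m n) + (n + 2) * n)%N.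
Proof.
have sum_max (f : 'I_n -> nat) c : (forall j, f j <= c)%N -> (\sum_j f j <= n * c)%N.
  by move=> fc; rewrite -[X in (X * c)%N]card_ord -sum_nat_const; apply: leq_sum.
apply: leq_add; apply: leq_mul => //; first by apply: sum_max => j; apply: slack_max.
by rewrite -[X in (_ <= X)%N]muln1; apply: sum_max => j; case: (d_found d j).
Qed.

Lemma potential_add x e O d (j k : 'I_n) l : sweep_inv A x j e O d ->
  pivot (d_R d) j = Some l -> d_pivs d l = Some k -> (k < j)%N ->
  (potential (cancel_pivot l k j d) + (m + n + 9) <= potential d)%N.
Proof.
move=> I jl lk kj; set c := - (d_R d l j / d_R d l k); have [kl _] := inv_pivs I lk.
have nkj : k != j by rewrite -val_eqE /= neq_ltn kj.
have AV i : (A *m col j (d_V d)) i 0 = d_R d i j.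
  by rewrite (inv_R I) colE mulmxA -colE mxE.
have [jl_n0 jl_max] := (pivotP _ _ _).1 jl.
have lt : (slack A (height (add_col c k j (d_R d)) j) < slack A (height (d_R d) j))%N.
  rewrite {2}/height jl; apply: (slack_lt (c := col j (d_V d))).
  - by rewrite AV.
  - by move=> i /jl_max; rewrite AV.
  - exact: height_add_col.
rewrite /potential /= addnAC leq_add2r -mulnSr leq_mul2l; apply/orP; right.
rewrite [X in (X < _)%N](bigD1 j) //= [X in (_ < X)%N](bigD1 j) //= -addSn leq_add //.
apply: leq_sum => i ij; rewrite (_ : height _ i = height (d_R d) i) //.
by apply: eq_height => a; rewrite add_col_neq.
Qed.

Lemma potential_record d (j : 'I_n) z : ~~ d_found d j ->
  (potential (record_column j z d) + (n + 2) <= potential d)%N.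
Proof.
move=> jf; rewrite /potential /= -addnA leq_add2l -mulnSr leq_mul2l.
apply/orP; right.
rewrite [X in (X < _)%N](bigD1 j) //= [X in (_ < X)%N](bigD1 j) //= ffunE eqxx jf.
by rewrite ltnS; apply: leq_sum => i /negPf ij; rewrite ffunE ij.
Qed.

(** The value of [footprint] when there are [n] distinct first coordinates, [n]
    rows of one column each, and [n] output vectors. *)
Definition peak_max : nat :=
  ((m * n + n) + (m * n + n) + n * n + m + n + n + 2 * n + n * n.+1 + 8)%N.

Lemma footprint_max d : (size (d_xs d) <= n)%N ->
  (\sum_(r <- d_rows d) (size r.2).+1 <= 2 * n)%N -> (size (d_out d) <= n)%N ->
  (footprint d <= peak_max)%N.
Proof.
move=> h1 h2 h3; rewrite /footprint /peak_max leq_add2r.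
by apply: leq_add; [apply: leq_add; [rewrite leq_add2l|]|rewrite leq_mul2r h3 orbT].
Qed.

Lemma inv_size x b e O d : sweep_inv A x b e O d -> (size (d_out d) <= n)%N.
Proof.
case/inv_out=> js [ujs _ e_out]; rewrite -(size_map fst) -/(unzip1 _) e_out size_map.
by rewrite -[X in (_ <= X)%N]card_ord -(card_uniqP ujs) max_card.
Qed.

Section Loops.
Variables (xs : seq int) (rows : seq (int * seq 'I_n)) (T : nat).
Hypothesis xs_size : (size xs <= n)%N.
Hypothesis rows_size : (\sum_(r <- rows) (size r.2).+1 <= 2 * n)%N.

(** [T] bounds the total time; [r] units of it are set aside for what remains to
    be run, on top of the potential. *)
Record within (r : nat) (P : data K m n -> Prop) st : Prop := Within {
  within_dat : P (dat st);
  within_xs : d_xs (dat st) = xs;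
  within_rows : d_rows (dat st) = rows;
  within_time : (time st + potential (dat st) + r <= T)%N;
  within_peak : (peak st <= peak_max)%N
}.

Lemma within_le r r' P Q st : (r' <= r)%N -> (P (dat st) -> Q (dat st)) ->
  within r P st -> within r' Q st.
Proof.
move=> rr' PQ [h1 h2 h3 h4 h5]; split=> //; first exact: PQ.
by apply: leq_trans h4; rewrite leq_add2l.
Qed.

Lemma within_step c c' f r P x b e O st : within (c' + r) P st ->
  (P (dat st) -> sweep_inv A x b e O (f (dat st))) ->
  d_xs (f (dat st)) = d_xs (dat st) -> d_rows (f (dat st)) = d_rows (dat st) ->
  (potential (f (dat st)) + c <= potential (dat st) + c')%N ->
  within r (sweep_inv A x b e O) (step c f st).
Proof.
move=> [h1 h2 h3 h4 h5] /(_ h1) I fxs frows pot; split=> //=.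
- by rewrite fxs.
- by rewrite frows.
- lia.
- rewrite geq_max h5 /= footprint_max ?fxs ?frows ?h2 ?h3 //; exact: inv_size I.
Qed.

Lemma within_tick c r x b e O st : within (c + r) (sweep_inv A x b e O) st ->
  within r (sweep_inv A x b e O) (tick c st).
Proof. by move=> W; apply: within_step W _ _ _ _. Qed.

(** The last, unsuccessful test of the loop and the update of [d_pivs] cost at most
    [2 + 3 + 1] units; each addition lowers the height of the column, which
    bounds the number of iterations. *)
Lemma reduce_within x e O (j : 'I_n) fuel r st :
  (height (d_R (dat st)) j < fuel)%N -> (gr j).1 <= x ->
  within (6 + r) (sweep_inv A x j e O) st ->
  exists2 st', reduce fuel j st = Some st' & within r (sweep_inv A x j.+1 e O) st'.
Proof.
move=> + jx; elim: fuel st => // fuel IH st; rewrite ltnS => h_fuel W.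
have I := within_dat W.
rewrite /reduce -/(while _ _ _) [while _ _ _]/=.
case jl: (pivot (d_R (dat st)) j) => [l|]; last first.
  have -> : reduce_step j st = (false, tick 2 st) by rewrite /reduce_step jl.
  exists (tick 2 st) => //; apply: (@within_tick 2).
  apply: within_le W => [|_]; first by lia.
  apply: (inv_skip I) => // k /andP[jk kj] _ l.
  by rewrite (_ : k = j) ?jl //; apply/val_inj/eqP; rewrite eqn_leq -ltnS kj.
case lk: (d_pivs (dat st) l) => [k|]; last first.
  have -> : reduce_step j st = (false, step 1 (put_pivs l j) (tick 3 (tick 2 st))).
    by rewrite /reduce_step jl /= lk.
  eexists; first by [].
  apply: (@within_step 1 1 _ _ (sweep_inv A x j e O)) => //.
    by apply/within_tick/within_tick; apply: within_le W => //; lia.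
  by move=> _; apply: inv_put_pivs => // k; rewrite lk.
have [kj|jk] := ltnP k j.
  have -> : reduce_step j st =
    (true, step (m + n)%N (put_matrices
         (add_col (- (d_R (dat st) l j / d_R (dat st) l k)) k j (d_R (dat st)))
         (add_col (- (d_R (dat st) l j / d_R (dat st) l k)) k j (d_V (dat st))))
       (tick 4 (tick 3 (tick 2 st)))).
    by rewrite /reduce_step jl /= lk kj.
  apply: IH.
    have [kl _] := inv_pivs I lk; apply: leq_ltn_trans (height_add_col _ jl kl) _.
      by rewrite -val_eqE /= neq_ltn kj.
    by move: h_fuel; rewrite /height jl.
  have I' := inv_add I jx jl lk kj; have pot := potential_add I jl lk kj.
  have [_ h2 h3 h4 h5] := W; split=> //=.
    by move: pot; rewrite /cancel_pivot; lia.
  rewrite !geq_max h5 !footprint_max ?h2 ?h3 //=; last exact: inv_size I.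
case: (eqVneq k j) => [kj|nkj].
  have -> : reduce_step j st = (false, tick 3 (tick 2 st)).
    by rewrite /reduce_step jl /= lk kj ltnn.
  eexists; first by [].
  do 2 apply: within_tick; apply: within_le W => [|_]; first by lia.
  apply: (inv_skip I) => // i /andP[ji ij] _ l'.
  have -> : i = j by apply/val_inj/eqP; rewrite eqn_leq -ltnS ij.
  by rewrite jl => -[<-]; rewrite lk kj.
have lt_jk : (j < k)%N by rewrite ltn_neqAle jk andbT eq_sym.
have -> : reduce_step j st = (false, step 1 (put_pivs l j) (tick 3 (tick 2 st))).
  by rewrite /reduce_step jl /= lk lt_jk ltnNge jk.
eexists; first by [].
apply: (@within_step 1 1 _ _ (sweep_inv A x j e O)) => //.
  by apply/within_tick/within_tick; apply: within_le W => //; lia.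
by move=> _; apply: inv_put_pivs => // i; rewrite lk => -[<-].
Qed.

Lemma output_within x b O (j : 'I_n) r st : (j < b)%N -> (gr j).1 <= x ->
  within (3 + r) (sweep_inv A x b j O) st ->
  within r (sweep_inv A x b j.+1 O) (output_step (x, (gr j).2) j st).
Proof.
move=> jb jx W; rewrite /output_step; case: ifP => [/andP[/eqP jN jf]|skip].
  apply: (@within_step _ 0 _ _ (sweep_inv A x b j O)) => //.
  - exact: within_tick.
  - by move=> I; apply: inv_record.
  - by have := potential_record (x, (gr j).2) jf; rewrite addn0 (addn2 n).
apply: within_le (within_tick W) => // I.
apply: (inv_skip_record I) => [|k /andP[jk kj] _]; first by rewrite leqnSn.
have -> : k = j by apply/val_inj/eqP; rewrite eqn_leq -ltnS kj.
by move=> jN; move: skip; rewrite jN eqxx /= => /negbFE.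
Qed.

Definition columns_from b (s : seq 'I_n) : Prop :=
  (b <= n)%N /\ map val s = iota b (n - b).

Lemma columns_from_cons b j s : columns_from b (j :: s) ->
  val j = b /\ columns_from b.+1 s.
Proof.
case=> bn /=; case E: (n - b)%N => [//|k] [-> e]; split=> //; split; first by lia.
by rewrite e; congr iota; lia.
Qed.

Lemma columns_from_cat b s t : columns_from b (s ++ t) ->
  columns_from (b + size s) t /\
  forall k : 'I_n, (b <= k < b + size s)%N -> k \in s.
Proof.
elim: s b => [|j s IH] b /=; first by rewrite addn0; split=> // k; lia.
case/columns_from_cons=> jb /IH[h1 h2]; rewrite addnS -addSn; split=> // k /andP[bk kb].
rewrite inE; case: eqP => [//|/eqP kj]; apply: h2; rewrite kb andbT ltn_neqAle bk andbT.
by rewrite -jb eq_sym.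
Qed.

(** Within a row the first coordinates of the labels increase, so the loop stops
    exactly when no column to be visited is left. *)
Lemma row_stop x y b j s t (k : 'I_n) : columns_from b (j :: s ++ t) ->
  {in j :: s, forall i, (gr i).2 = y} -> ~~ ((gr j).1 <= x) ->
  (b <= k < b + size (j :: s))%N -> ~~ ((gr k).1 <= x).
Proof.
move=> cols sy jx kb.
have ks := (@columns_from_cat b (j :: s) t cols).2 k kb.
have [jb _] := columns_from_cons cols.
have /(@bg_colex _ _ _ A) : (j <= k)%N by rewrite [val j]jb; case/andP: kb.
rewrite /colex (sy j) ?mem_head // (sy k) // ltxx eqxx /= => jk.
by apply: contra jx; apply: le_trans.
Qed.

Lemma row_reduce_within x y e O fuel s t b r st : (m < fuel)%N ->
  {in s, forall j, (gr j).2 = y} -> columns_from b (s ++ t) ->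
  within (7 * size s + 1 + r) (sweep_inv A x b e O) st ->
  exists2 st', for_while (fun j => (gr j).1 <= x) (reduce fuel) s st = Some st' &
    within r (sweep_inv A x (b + size s) e O) st'.
Proof.
move=> fuel_m; elim: s b st => [|j s IH] b st sy cols W.
  by exists (tick 1 st); rewrite //= addn0; apply: within_tick.
rewrite /=; case: ifP => [jx|/negbT jx]; last first.
  eexists; first by []; apply: within_tick; apply: within_le W => [|I]; first by lia.
  apply: (inv_skip I) => [|k kb kx]; first exact: leq_addr.
  by have := row_stop cols sy jx kb; rewrite kx.
have [jb cols'] := columns_from_cons cols.
have [|||st' -> W'] := @reduce_within x e O j fuel (7 * size s + 1 + r) (tick 1 st).
- apply: leq_ltn_trans fuel_m; rewrite /height; case: (pivot _ _) => // l; exact: ltn_ord.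
- exact: jx.
- rewrite jb; apply: within_tick; apply: within_le W => //=; lia.
rewrite /= addnS -addSn; apply: IH => [i si||] //.
  by apply: sy; rewrite inE si orbT.
by rewrite -jb.
Qed.

Lemma row_output_within x y b O s t e r st :
  {in s, forall j, (gr j).2 = y} -> columns_from e (s ++ t) -> (e + size s <= b)%N ->
  within (4 * size s + 1 + r) (sweep_inv A x b e O) st ->
  exists2 st', for_while (fun j => (gr j).1 <= x)
      (fun j st => Some (output_step (x, y) j st)) s st = Some st' &
    within r (sweep_inv A x b (e + size s) O) st'.
Proof.
elim: s e st => [|j s IH] e st sy cols eb W.
  by exists (tick 1 st); rewrite //= addn0; apply: within_tick.
rewrite /=; case: ifP => [jx|/negbT jx]; last first.
  eexists; first by []; apply: within_tick; apply: within_le W => [|I]; first by lia.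
  apply: (inv_skip_record I) => [|k kb kx]; first by rewrite leq_addr.
  by have := row_stop cols sy jx kb; rewrite kx.
have [je cols'] := columns_from_cons cols.
rewrite /= addnS -addSn; apply: IH => [i si|//||] //.
- by apply: sy; rewrite inE si orbT.
- by move: eb; rewrite /= addnS.
rewrite -(sy j) ?mem_head // -je; apply: output_within => //.
  by move: eb; rewrite /= je; lia.
by rewrite je; apply: within_tick; apply: within_le W => //=; lia.
Qed.

(** A row of [k] columns costs [7 * k + 1] for reduction, [4 * k + 1] for output
    and 1 for the loop, which is at most [11 * k.+1]; by [rows_size] this adds up
    to at most [22 * n] for all rows. *)
Lemma rows_within x fuel (s : seq (int * seq 'I_n)) b O r st : (m < fuel)%N ->
  (forall row, row \in s -> {in row.2, forall j, (gr j).2 = row.1}) ->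
  columns_from b (flatten (unzip2 s)) ->
  within (11 * (\sum_(row <- s) (size row.2).+1) + 1 + r) (sweep_inv A x b b O) st ->
  exists2 st', for_all (fun row => process A fuel (x, row.1) row.2) s st = Some st' &
    within r (sweep_inv A x n n O) st'.
Proof.
move=> fuel_m; elim: s b st => [|[y js] s IH] b st s_ok cols W.
  have nb : b = n by case: cols => bn /= /(congr1 size); rewrite size_iota /=; lia.
  rewrite nb in W.
  exists (tick 1 st) => //; apply: within_tick; apply: within_le W => //.
  by rewrite big_nil.
rewrite /for_all /= -/(for_all _ _ _) /process /=; rewrite big_cons /= in W.
set R := (\sum_(row <- s) _)%N in W.
have js_y : {in js, forall j, (gr j).2 = y} by apply: (s_ok (y, js)); apply: mem_head.
have [|st1 -> W1] := row_reduce_within (st := tick 1 st) (x := x) (e := b) (O := O)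
  (r := 4 * size js + 1 + (11 * R + 1 + r)) fuel_m js_y cols.
  by apply: within_tick; apply: within_le W => //; move: R (size js) => {}R k; lia.
have [|st2 /= -> W2] := row_output_within js_y cols _ W1; first by [].
apply: IH W2 => [row row_s|]; first by apply: s_ok; rewrite inE row_s orbT.
by have [] := columns_from_cat cols.
Qed.

Hypothesis rows_ok :
  forall row, row \in rows -> {in row.2, forall j, (gr j).2 = row.1}.
Hypothesis rows_columns : columns_from 0 (flatten (unzip2 rows)).

(** Completeness at an earlier [x] persists, because the output only grows. *)
Lemma sweep_within fuel (s : seq int) x b e O r st : (m < fuel)%N -> path <=%R x s ->
  (forall x', x' \in xs -> x' \in s \/ complete A x' (d_out (dat st))) ->
  within (size s * (22 * n + 2) + 1 + r) (sweep_inv A x b e O) st ->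
  exists2 st', for_all (fun x st => for_all (fun row => process A fuel (x, row.1) row.2)
      (d_rows (dat st)) st) s st = Some st' &
    (exists x b e O, within r (sweep_inv A x b e O) st') /\
    forall x', x' \in xs -> complete A x' (d_out (dat st')).
Proof.
move=> fuel_m; elim: s x b e O st => [|x' s IH] x b e O st /=.
  move=> _ compl W; exists (tick 1 st) => //; split.
    by exists x, b, e, O; apply: within_tick.
  by move=> x' /compl[].
case/andP=> xx' path_s compl W.
rewrite /for_all /= -/(for_all _ _ _) (within_rows W).
have [|st1 E W1] := @rows_within x' fuel rows 0 (d_out (dat st))
    (size s * (22 * n + 2) + 1 + r) (tick 1 st) fuel_m rows_ok rows_columns.
  apply: (@within_step 1 1 _ _ (sweep_inv A x b e O)) => //; last by apply: inv_restart.
  apply: within_le W => //; rewrite mulSn; lia.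
have I1 := within_dat W1.
rewrite E /=; apply: IH path_s _ W1 => x''.
case/compl=> [|C]; last by right; apply: complete_grow C; apply: inv_grow I1.
by rewrite inE => /orP[/eqP ->|]; [right; apply: inv_complete I1|left].
Qed.

End Loops.
End Cost.

(** * The grid *)

Lemma insert_spec x (s : seq int) : let: (c, t) := insert x s in
  [/\ (c <= 2 * size s)%N, t =i x :: s, (size t <= (size s).+1)%N &
      sorted <=%R s -> sorted <=%R t].
Proof.
elim: s => [|y s IH] /=; first by split.
case: eqVneq => [->|xy]; first by split=> // z; rewrite !inE orbA orbb.
case: ltP => [lt_xy|le_yx]; first by split=> //= [|ys]; [lia|rewrite ltW].
case: (insert x s) IH => c t [hc ht hs ho]; split=> /=.
- by lia.
- by move=> z; rewrite !inE ht inE orbCA.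
- by rewrite ltnS.
rewrite !(path_sortedE le_trans) => /andP[ys /ho ->]; rewrite andbT.
by apply/allP => z; rewrite ht inE => /orP[/eqP -> //|]; apply/allP.
Qed.

Section Setup.
Variables (K : fieldType) (m n : nat) (A : bigraded_matrix K m n).
Local Notation gr := (bg_gr A).

Definition initial xs rows : data K m n :=
  Data A 1%:M [ffun => None] [ffun => false] xs rows [::].

(** What [setup] has built after visiting the columns in [s]. Together with
    [grid_nonempty], [grid_columns] bounds the number of rows by that of
    columns. *)
Record grid_of (s : seq 'I_n) xs (rows : seq (int * seq 'I_n)) : Prop := GridOf {
  grid_columns : flatten (unzip2 rows) = s;
  grid_labels : forall row, row \in rows -> {in row.2, forall j, (gr j).2 = row.1};
  grid_nonempty : forall row, row \in rows -> (0 < size row.2)%N;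
  grid_sorted : sorted <=%R xs;
  grid_xs : forall j, j \in s -> (gr j).1 \in xs;
  grid_size : (size xs <= size s)%N
}.

Lemma grid_rows_size s xs rows : grid_of s xs rows ->
  (\sum_(row <- rows) (size row.2).+1 <= 2 * size s)%N.
Proof.
case=> <- _ ne _ _ _; elim: rows ne => [|row rows IH] ne; first by rewrite big_nil.
rewrite big_cons /= size_cat mulnDr; apply: leq_add.
  by rewrite mul2n -addnn -addn1 leq_add2l ne // mem_head.
by apply: IH => row' h; apply: ne; rewrite inE h orbT.
Qed.

Lemma initial_footprint s xs rows : (size s <= n)%N -> grid_of s xs rows ->
  (footprint (initial xs rows) <= peak_max m n)%N.
Proof.
move=> sn G; apply: footprint_max => //=; first exact: leq_trans (grid_size G) sn.
by apply: leq_trans (grid_rows_size G) _; rewrite leq_mul2l sn.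
Qed.

Lemma grid_cons j s xs rows : grid_of s xs rows -> grid_of (j :: s)
  (insert (gr j).1 xs).2
  (if rows is (y, js) :: rows' then
       if (gr j).2 == y then (y, j :: js) :: rows' else ((gr j).2, [:: j]) :: rows
     else [:: ((gr j).2, [:: j])]).
Proof.
case=> cols labels ne sorted_xs xs_s size_xs.
case E: (insert _ _) => [c xs'] /=; have := insert_spec (gr j).1 xs; rewrite E.
case=> _ mem_xs' size_xs' /(_ sorted_xs) sorted_xs'.
have xs'_s k : k \in j :: s -> (gr k).1 \in xs'.
  rewrite mem_xs' !inE => /orP[/eqP ->|/xs_s ->]; by rewrite ?eqxx ?orbT.
have {}size_xs' : (size xs' <= size (j :: s))%N by apply: leq_trans size_xs' _.
case: rows cols labels ne => [|[y js] rows] cols labels ne.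
  split=> //= [|row|row]; rewrite -?cols // inE => /eqP -> // k.
  by rewrite inE => /eqP ->.
case: eqP => [jy|_]; split=> //= [|row|row]; rewrite -?cols //.
- rewrite inE => /orP[/eqP -> /= k|h]; last by apply: labels; rewrite inE h orbT.
  rewrite inE => /orP[/eqP -> //|]; apply: (labels (y, js)); exact: mem_head.
- by rewrite inE => /orP[/eqP -> //|h]; apply: ne; rewrite inE h orbT.
- by rewrite inE => /orP[/eqP -> k|/labels //]; rewrite inE => /eqP ->.
- by rewrite inE => /orP[/eqP -> //|/ne].
Qed.

(** The columns come from the last one to the first one, so each of them is put in
    front of those already treated. An insertion costs at most [2 * n] comparisons,
    and the rest of the iteration 4 units. *)
Lemma setup_loop s t xs rows st : (size (s ++ t) <= n)%N -> grid_of t xs rows ->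
  dat st = initial xs rows -> (peak st <= peak_max m n)%N ->
  exists st' xs' rows',
    [/\ for_all (fun j st => Some (insert_row A j (insert_x A j st))) s st = Some st',
        dat st' = initial xs' rows', grid_of (rev s ++ t) xs' rows',
        (time st' <= time st + (2 * n + 4) * size s + 1)%N &
        (peak st' <= peak_max m n)%N].
Proof.
elim: s t xs rows st => [|j s IH] t xs rows st /= size_n G e_dat e_peak.
  exists (tick 1 st), xs, rows; split=> //=; first by lia.
  by rewrite geq_max e_peak e_dat (initial_footprint _ G).
have size_t : (size t < n)%N by move: size_n; rewrite size_cat; lia.
set st1 := insert_row A j (insert_x A j (tick 1 st)).
case E: (insert (gr j).1 xs) => [c xs1].
have [c_max _ _ _] : [/\ (c <= 2 * size xs)%N, xs1 =i (gr j).1 :: xs,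
    (size xs1 <= (size xs).+1)%N & sorted <=%R xs -> sorted <=%R xs1].
  by have := insert_spec (gr j).1 xs; rewrite E.
have G1 := grid_cons j G; rewrite E /= in G1.
set rows1 := (X in grid_of _ _ X) in G1.
have dat1 : dat st1 = initial xs1 rows1.
  by rewrite /st1 /insert_x /= e_dat E /insert_row /= ?e_dat.
have time1 : time st1 = (time st + 1 + c.+1 + 2)%N.
  by rewrite /st1 /insert_x /= e_dat E /insert_row /= ?e_dat.
have peak1 : (peak st1 <= peak_max m n)%N.
  have size_xs1 : (size xs1 <= n)%N by apply: leq_trans (grid_size G1) _.
  rewrite /st1 /insert_x /= e_dat E /insert_row /= e_dat /= !geq_max e_peak.
  rewrite (initial_footprint _ G) ?(ltnW size_t) //=.
  rewrite (@footprint_max _ _ _ (initial xs1 rows)) //=; last first.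
    by apply: leq_trans (grid_rows_size G) _; rewrite leq_mul2l ltnW.
  exact: initial_footprint G1.
have [|st' [xs' [rows' [run dat' G' time' peak']]]] := IH _ _ _ st1 _ G1 dat1 peak1.
  by move: size_n; rewrite !size_cat /=; lia.
exists st', xs', rows'; split=> //.
  by rewrite rev_cons cat_rcons.
have xs_n : (size xs <= n)%N by apply: leq_trans (grid_size G) (ltnW size_t).
by rewrite time1 in time'; lia.
Qed.

Lemma setup_spec : exists st xs rows,
  [/\ setup A (start A) = Some st, dat st = initial xs rows,
      grid_of (enum 'I_n) xs rows,
      (time st <= 2 * (m * n + n) + n * n + m + n + 8 + (2 * n + 4) * n + 1)%N &
      (peak st <= peak_max m n)%N].
Proof.
have [||||st [xs [rows [run e_dat G time_st peak_st]]]] :=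
    @setup_loop (rev (enum 'I_n)) [::] [::] [::] (start A).
- by rewrite cats0 size_rev size_enum_ord.
- by split.
- by [].
- by apply: (@initial_footprint [::]) => //; split.
exists st, xs, rows; split=> //; first by rewrite revK cats0 in G.
apply: leq_trans time_st _; rewrite size_rev size_enum_ord.
by rewrite /= /footprint /= big_nil mul0n !addn0; lia.
Qed.

Lemma initial_inv x xs rows : sweep_inv A x 0 0 [::] (initial xs rows).
Proof.
split=> //=; first by rewrite mulmx1.
- by move=> j; rewrite mxE eqxx.
- by move=> i j; rewrite mxE; case: (eqVneq i j) => [->|_]; rewrite ?leqnn ?eqxx.
- by move=> i j; rewrite mxE; case: (eqVneq i j) => [->|_]; rewrite ?eqxx //; left.
- by move=> l k; rewrite ffunE.
- by move=> j; rewrite ffunE.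
- by exists [::]; split=> // j; rewrite ffunE.
Qed.

(** The initial storage, [setup], the initial potential, and the sweep, where a pass
    over the rows costs at most [22 * n + 2]. *)
Definition time_max : nat :=
  (2 * (m * n + n) + n * n + m + n + 8 + (2 * n + 4) * n + 1
   + ((m + n + 9) * (n * minn m n) + (n + 2) * n) + (n * (22 * n + 2) + 1))%N.

(** The fuel suffices since the height of a column is at most [m]. *)
Theorem kerbasis_spec : exists st, [/\ kerbasis A m.+1 = Some st,
  kernel_spec A (d_out (dat st)), (time st <= time_max)%N & (peak st <= peak_max m n)%N].
Proof.
have [st0 [xs [rows [run0 dat0 G time0 peak0]]]] := setup_spec.
have size_xs : (size xs <= n)%N by have := grid_size G; rewrite size_enum_ord.
have size_rows : (\sum_(r <- rows) (size r.2).+1 <= 2 * n)%N.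
  by have := grid_rows_size G; rewrite size_enum_ord.
have cols : columns_from 0 (flatten (unzip2 rows)).
  by split=> //; rewrite (grid_columns G) val_enum_ord subn0.
have := @sweep_within K m n A xs rows time_max size_xs size_rows (grid_labels G) cols
  m.+1 xs (head 0 xs) 0 0 [::] 0 st0.
case=> [//||x xs_x||st [run [[x [b [e [O W]]]] compl]]].
- by have := grid_sorted G; case: (xs) => //= y ys; rewrite lexx.
- by left.
- split; rewrite ?dat0 //; first exact: initial_inv.
  have pot := potential_max A (initial xs rows).
  have cost : (size xs * (22 * n + 2) <= n * (22 * n + 2))%N.
    by rewrite leq_mul2r size_xs orbT.
  by rewrite /time_max; lia.
exists st; split.
- by rewrite /kerbasis run0 /= /sweep dat0 /= run.
- apply: inv_spec (within_dat W) _ => j; apply: compl.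
  by apply: (grid_xs G); rewrite mem_enum.
- by have := within_time W; lia.
- exact: within_peak W.
Qed.

End Setup.

(** * Complexity bounds *)

Lemma time_bound m n : (0 < m)%N -> (0 < n)%N ->
  (time_max m n <= 100 * (n * (m + n) * minn m n))%N.
Proof.
move=> m0 n0; have mu0 : (0 < minn m n)%N by rewrite leq_min m0.
rewrite /time_max; move: (minn m n) mu0 => u u0.
have mn_u : (m * n <= n * (m + n) * u)%N by nia.
have nn_u : (n * n <= n * (m + n) * u)%N by nia.
have nu_u : (n * u <= n * (m + n) * u)%N by nia.
have n_n : (n <= n * n)%N by nia.
have m_mn : (m <= m * n)%N by nia.
have e : ((m + n + 9) * (n * u) = n * (m + n) * u + 9 * (n * u))%N by nia.
move: (n * (m + n) * u)%N mn_u nn_u nu_u e => X; rewrite !mulnDl !mulnDr => *; nia.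
Qed.

Lemma peak_bound m n : (0 < n)%N -> (peak_max m n <= 100 * (m * n + n ^ 2))%N.
Proof.
move=> n0; rewrite /peak_max -mulnn mulnS.
have n_n : (n <= n * n)%N by nia.
have m_mn : (m <= m * n)%N by nia.
lia.
Qed.

Theorem proposition3p6 (K : fieldType) :
  exists C : nat,
  forall (F F' : bipersistence K) (gamma : {linear F -> F'}) (m n : nat)
         (A : bigraded_matrix K m n) (B : 'I_n -> F)
         (B' : 'I_m -> F') (g' : 'I_m -> grade),
    grade_preserving gamma ->
    is_basis (fun _ : F => True) B (bg_gr A) ->
    is_basis (fun _ : F' => True) B' g' ->
    represents gamma B B' g' A ->
    exists (fuel : nat) (st : machine K m n),
      [/\ kerbasis A fuel = Some st,
          exists b : 'I_(size (d_out (dat st))) -> F,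
            (forall i, coordinates B (bg_gr A) (output_gr i) (b i) (output_vec i)) /\
            is_basis (fun v : F => gamma v = 0) b (@output_gr K m n st),
          (0 < m)%N -> (0 < n)%N ->
            (time st <= C * (n * (m + n) * minn m n))%N &
          (0 < n)%N -> (peak st <= C * (m * n + n ^ 2))%N].
Proof.
exists 100%N => F F' gamma m n A B B' g' gamma_gr B_basis B'_basis A_gamma.
have [st [run out_spec time_st peak_st]] := kerbasis_spec A.
exists m.+1, st; split=> //.
- exact: kernel_spec_basis gamma_gr B_basis B'_basis A_gamma _ out_spec.
- by move=> m0 n0; apply: leq_trans time_st (time_bound m0 n0).
- by move=> n0; apply: leq_trans peak_st (peak_bound m n0).
Qed.
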